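(* Let $\circledast$ be nothing, ''$\le1$'' or ''$1$''. Let $\mathcal B$ be a convenient barycentric algebra, and assume that $\mathcal B$ is a cone if $\circledast$ is nothing, resp. that $\mathcal B$ is pointed if $\circledast$ is ''$\le1$'', resp. that $\mathcal B$ is compact and non-empty if $\circledast$ is ''$1$''. Then every continuous valuation $\nu$ (resp. every subprobability valuation if $\circledast$ is ''$\le1$'', resp. every probability valuation if $\circledast$ is ''$1$'') on $\mathcal B$ has a unique barycenter $\beta(\nu)$, and the barycenter map $\beta\colon\mathbf V_{\circledast}\mathcal B\to\mathcal B$ is continuous.
   Context: $\mathbb R_+=[0,\infty[$ and $\overline{\mathbb R}_+=[0,\infty]$ carry the Scott topology (open sets $\{t:t>a\}$, the whole set, $\emptyset$); lower semicontinuous means continuous into $\overline{\mathbb R}_+$. The specialization preordering of a space is: $x\le y$ iff every open neighborhood of $x$ contains $y$. Compactness does not include any separation axiom. A cone is a commutative monoid $(\mathfrak C,+,0)$ with an action of $\mathbb R_+$ satisfying $0\cdot x=0$, $(ab)\cdot x=a\cdot(b\cdot x)$, $1\cdot x=x$, $a\cdot0=0$, $a\cdot(x+y)=a\cdot x+a\cdot y$, $(a+b)\cdot x=a\cdot x+b\cdot x$; it is topological if it has a topology making $+$ and $\cdot$ jointly continuous. A barycentric algebra is a set with operations $+_a$, $a\in[0,1]$, such that $x+_1y=x$, $x+_ax=x$, $x+_ay=y+_{1-a}x$, $(x+_ay)+_bz=x+_{ab}(y+_{\frac{(1-a)b}{1-ab}}z)$ if $a,b<1$; cones are barycentric algebras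 with $x+_ay=a\cdot x+(1-a)\cdot y$. It is topological if it has a topology making $(x,a,y)\mapsto x+_ay$ jointly continuous, $[0,1]$ having its metric topology (for a cone $\mathcal B$, the topology is understood to make it a topological cone). It is pointed if it has a distinguished element $\bot$ least in the specialization preordering; $a\cdot x:=x+_a\bot$. A cone is pointed with $\bot=0$. A map is affine if it commutes with all $+_a$, and (pointed case) linear if affine and $f(a\cdot x)=a\cdot f(x)$ for all $a\in[0,1]$; on cones this is usual linearity. A convenient barycentric algebra is a topological barycentric algebra $\mathcal B$ that is: linearly separated (for all $x\not\le y$ there is an affine lower semicontinuous $\Lambda\colon\mathcal B\to\overline{\mathbb R}_+$ with $\Lambda(x)>\Lambda(y)$); locally convex-compact (every point has a neighborhood base of convex compact sets, convex meaning closed under all $+_a$); and sober ($T_0$ and every irreducible closed set is the closure of a point). A continuous valuation on a space $X$ is a map $\nu$ from the open subsets of $X$ to $\overline{\mathbb R}_+$ with $\nu(\emptyset)=0$, $\nu(U)+\nu(V)=\nu(U\cup V)+\nu(U\cap V)$, and Scott-continuous (monotone and preserving directed suprema); it is a subprobability (resp. probability) valuation if $\nu(X)\le1$ (resp. $=1$). $\mathbf VX$, $\mathbf V_{\le1}X$, $\mathbf V_1X$ are the corresponding spaces with the weak topology, generated by the sets $\{\nu:\nu(U)>r\}$, $U$ open, $r>0$. For $h\colon X\to\overline{\mathbb R}_+$ lower semicontinuous, $\int h\,d\nu=\int_0^\infty\nu(h^{-1}(]t,\infty]))\,dt$ (Riemann integral). Barycenters: if $\mathcal B$ is a semitopological barycentric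 algebra and $\nu\in\mathbf V_1\mathcal B$, a barycenter of $\nu$ is a point $x_0\in\mathcal B$ such that $\Lambda(x_0)=\int\Lambda\,d\nu$ for every affine lower semicontinuous $\Lambda\colon\mathcal B\to\overline{\mathbb R}_+$. If $\mathcal B$ is pointed and $\nu\in\mathbf V_{\le1}\mathcal B$, or if $\mathcal B$ is a semitopological cone and $\nu\in\mathbf V\mathcal B$, the same condition is required for every linear lower semicontinuous $\Lambda$ (on the intersections of their domains these definitions agree). *)

(* Defs.v *)
From HB Require Import structures.
From mathcomp Require Import all_boot all_order all_algebra.
From mathcomp Require Import all_classical all_reals all_analysis.

Set Implicit Arguments.
Unset Strict Implicit.
Unset Printing Implicit Defensive.

Import Order.TTheory GRing.Theory Num.Theory.
Import numFieldNormedType.Exports.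

Local Open Scope classical_set_scope.
Local Open Scope ring_scope.
Local Open Scope convex_scope.

(* [0, +oo[ with the Scott topology: the open sets are exactly set0, setT and
   the rays ]a, +oo[ (those with a < 0 are setT). The alias keeps this topology
   apart from the metric one. *)
Definition half_line (R : realType) : Type := {nonneg R}.
HB.instance Definition _ (R : realType) := Choice.copy (half_line R) {nonneg R}.
HB.instance Definition _ (R : realType) :=
  isSubBaseTopological.Build (half_line R)
    [set: R] (fun a => [set t : half_line R | a < (t : {nonneg R})%:num]).

Definition unit_interval (R : realType) : Type :=
  initial_topology (fun a : {i01 R} => a%:num : R).
HB.instance Definition _ (R : realType) := Topological.on (unit_interval R).

(* A barycentric algebra is a [convType]: [x <| a |> y] is x +_a y, that is,
   a.x + (1 - a).y in a cone. *)
#[short(type=topConvType)]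
HB.structure Definition TopConv (R : realType) :=
  {B of Topological B & ConvexSpace R B}.

Definition topological_barycentric (R : realType) (B : topConvType R) :=
  continuous (fun p : B * unit_interval R * B =>
    p.1.1 <| (p.1.2 : {i01 R}) |> p.2).

(* The monoid is an [nmodType] with continuous addition, and the last axiom
   says that the underlying barycentric algebra is the one the cone induces.
   Joint continuity of the action is for the Scott topology of [half_line]. *)
HB.mixin Record isTopologicalCone (R : realType) C
    & TopologicalNmodule C & ConvexSpace R C := {
  cone_scale : {nonneg R} -> C -> C;
  cone_scale0l : forall x, cone_scale 0%:nng x = 0;
  cone_scaleA : forall (a b : {nonneg R}) x,
    cone_scale (a%:num * b%:num)%:nng x = cone_scale a (cone_scale b x);
  cone_scale1 : forall x, cone_scale 1%:nng x = x;
  cone_scale0r : forall a, cone_scale a 0 = 0;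
  cone_scaleDr : forall a x y,
    cone_scale a (x + y) = cone_scale a x + cone_scale a y;
  cone_scaleDl : forall (a b : {nonneg R}) x,
    cone_scale (a%:num + b%:num)%:nng x = cone_scale a x + cone_scale b x;
  cone_scale_continuous :
    continuous (fun p : half_line R * C => cone_scale p.1 p.2);
  cone_convE : forall (a : {i01 R}) x y,
    x <| a |> y = cone_scale a%:num%:nng x + cone_scale (1 - a%:num)%:nng y
}.

#[short(type=topConeType)]
HB.structure Definition TopCone (R : realType) :=
  {C of TopologicalNmodule C & ConvexSpace R C & isTopologicalCone R C}.

Definition specialization_le (X : topologicalType) (x y : X) :=
  forall U : set X, open U -> U x -> U y.

Definition irreducible_closed (X : topologicalType) (C : set X) :=
  [/\ closed C, C !=set0 &
    forall F G : set X, closed F -> closed G ->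
      C `<=` F `|` G -> C `<=` F \/ C `<=` G].

Definition sober (X : topologicalType) :=
  @kolmogorov_space X /\
  forall C : set X, irreducible_closed C -> exists x, C = closure [set x].

Record opens (X : topologicalType) := Opens {
  opens_set :> set X;
  opens_open : open opens_set }.

Section opens.
Context {X : topologicalType}.
Implicit Types U V : opens X.

Definition opens0 : opens X := Opens open0.
Definition opensT : opens X := Opens openT.
Definition opensI U V : opens X := Opens (openI (opens_open U) (opens_open V)).
Definition opensU U V : opens X := Opens (openU (opens_open U) (opens_open V)).
Definition opens_bigcup (D : set (opens X)) : opens X :=
  Opens (bigcup_open (fun U (_ : D U) => opens_open U)).

Definition directed_opens (D : set (opens X)) :=
  D !=set0 /\
  forall U V, D U -> D V -> exists W, [/\ D W, U `<=` W & V `<=` W].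

End opens.

Record lscfun (R : realType) (X : topologicalType) := LscFun {
  lscfun_fun :> X -> \bar R;
  lscfun_ge0 : forall x, (0 <= lscfun_fun x)%E;
  lscfun_lsc : lower_semicontinuous lscfun_fun }.

Definition superlevel (R : realType) (X : topologicalType) (h : lscfun R X)
    (t : R) : opens X :=
  Opens ((lower_semicontinuousP h).1 (@lscfun_lsc R X h) t).

Section convenient.
Context {R : realType} {B : topConvType R}.

Definition affine (L : lscfun R B) :=
  forall (a : {i01 R}) (x y : B),
    L (x <| a |> y) = (a%:num%:E * L x + (1 - a%:num)%:E * L y)%E.

Definition convex_subset (A : set B) :=
  forall (a : {i01 R}) (x y : B), A x -> A y -> A (x <| a |> y).

Definition linearly_separated :=
  forall x y : B, ~ specialization_le x y ->
    exists2 L : lscfun R B, affine L & (L y < L x)%E.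

Definition locally_convex_compact :=
  forall (x : B) (U : set B), nbhs x U ->
    exists K : set B, [/\ nbhs x K, K `<=` U, compact K & convex_subset K].

End convenient.

Definition convenient (R : realType) (B : topConvType R) :=
  [/\ topological_barycentric B, @linearly_separated R B,
      @locally_convex_compact R B & sober B].

Definition least (X : topologicalType) (bot : X) :=
  forall x, specialization_le bot x.

Definition pointed_linear (R : realType) (B : topConvType R) (bot : B)
    (L : lscfun R B) :=
  affine L /\
  forall (a : {i01 R}) (x : B), L (x <| a |> bot) = (a%:num%:E * L x)%E.

Definition cone_linear (R : realType) (C : topConeType R) (L : lscfun R C) :=
  (forall x y : C, L (x + y) = (L x + L y)%E) /\
  (forall (a : {nonneg R}) (x : C), L (cone_scale a x) = (a%:num%:E * L x)%E).

Record valuation (R : realType) (X : topologicalType) := Valuation {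
  valuation_fun :> opens X -> \bar R;
  valuation_ge0 : forall U, (0 <= valuation_fun U)%E;
  valuation0 : valuation_fun opens0 = 0%E;
  valuation_modular : forall U V,
    (valuation_fun U + valuation_fun V =
     valuation_fun (opensU U V) + valuation_fun (opensI U V))%E;
  valuation_monotone : forall U V : opens X,
    U `<=` V -> (valuation_fun U <= valuation_fun V)%E;
  valuation_scott : forall D : set (opens X), directed_opens D ->
    valuation_fun (opens_bigcup D) = ereal_sup (valuation_fun @` D) }.

Section valuations.
Context {R : realType} {X : topologicalType}.

HB.instance Definition _ := gen_eqMixin (valuation R X).
HB.instance Definition _ := gen_choiceMixin (valuation R X).

HB.instance Definition _ := isSubBaseTopological.Build (valuation R X)
  [set W : set (valuation R X) | exists (U : opens X) (r : R),
     0 < r /\ W = [set nu | (r%:E < nu U)%E]] id.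

(* The integrand is antitone in t, so that the Lebesgue integral is the
   improper Riemann integral. *)
Definition val_integral (nu : valuation R X) (h : lscfun R X) : \bar R :=
  (\int[lebesgue_measure]_(t in `[0%R, +oo[) nu (superlevel h t))%E.

End valuations.

(* Coerced to types through [set_type], these sets carry the subspace topology
   of the weak topology. *)
Definition subprob_valuation (R : realType) (X : topologicalType) :
  set (valuation R X) := [set nu | (nu opensT <= 1)%E].

Definition prob_valuation (R : realType) (X : topologicalType) :
  set (valuation R X) := [set nu | nu opensT = 1%E].

Arguments subprob_valuation : clear implicits.
Arguments prob_valuation : clear implicits.

Definition represents (R : realType) (X : topologicalType)
    (P : lscfun R X -> Prop) (nu : valuation R X) (x0 : X) :=
  forall L : lscfun R X, P L -> L x0 = val_integral nu L.

Definition cone_barycenter (R : realType) (C : topConeType R)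
    (nu : valuation R C) (x0 : C) :=
  represents (@cone_linear R C) nu x0.

Definition pointed_barycenter (R : realType) (B : topConvType R) (bot : B)
    (nu : subprob_valuation R B) (x0 : B) :=
  represents (pointed_linear bot) (set_val nu) x0.

Definition barycenter (R : realType) (B : topConvType R)
    (nu : prob_valuation R B) (x0 : B) :=
  represents (@affine R B) (set_val nu) x0.

Definition continuous_barycenter_map (V X : topologicalType)
    (bary : V -> X -> Prop) :=
  exists beta : V -> X, (forall nu, unique (bary nu) (beta nu)) /\ continuous beta.

(* Main.v *)
Require Import Defs.
From mathcomp Require Import all_boot all_order all_algebra.
From mathcomp Require Import all_classical all_reals all_analysis.
From mathcomp Require Import measurable_realfun.
From mathcomp Require Import lra.

(** Call affine (pointed linear, linear) lower semicontinuous functions test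
    functions.  Uniqueness of barycenters is separation: two barycenters have the
    same value under every test function, so that each is below the other.

    Existence and continuity rest on approximating a valuation [nu] by finite
    formal sums [xi] of weighted convex compact sets [K_i] containing open sets
    [V_i], the relation [way_below xi nu] being that every nonempty subfamily has
    total weight less than the [nu]-measure of the union of its [V_i].  Let [region xi]
    be the upward closure of the weighted sum of the [K_i].  It is compact, as an
    image of a product of compact sets ([region_compact]).

    These regions are filtered.  Indeed [nu] can be split along finitely many opens
    ([valuation_split]) and each part approximated by bricks inside the corresponding
    open, so that some [zeta] way below [nu] has, for each subfamily of [xi], enough
    weight in bricks contained in one of its [V_i] ([approx_family]).  The marriage condition for weights then
    distributes the weights of [zeta] over the bricks of [xi] that contain them
    ([transport]), and convexity gives [region zeta `<=` region xi]
    ([region_refine]).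

    By sobriety, a closed set that meets all regions meets their intersection, the
    core of [nu], which is compact ([sober_well_filtered],
    [compact_bigcap_filtered]).  Every test function [L] is at least its integral
    on the core ([core_ge]: approximate along the superlevels of [L]), and comes
    arbitrarily close to it there ([core_sublevel]: the integral of [L] is at least
    the weighted sum of the infima of [L] on the [V_i]).  Since [L + L'] is a test
    function and integrals are subadditive ([val_integral_subadditive]), a point of
    the core at which [L + L'] is almost minimal is one where [L] and [L'] are; by
    compactness some point of the core has the value prescribed by the integral
    under every test function ([core_represents]).  This is the barycenter, and by
    separation it is the least point of the core.

    For continuity, if the barycenter of [nu] lies in an open set [U], so does the
    core, hence some [region xi] with [xi] way below [nu].  The valuations that have
    [xi] way below them are a weak neighbourhood of [nu], and their barycenters
    belong to [region xi] ([represents_continuous]).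

    The three cases differ in how the mass missing from [xi] is handled: by a free
    point of the compact space, where a pointed algebra or a cone is compact because
    it has a least element. *)

Set Implicit Arguments.
Unset Strict Implicit.
Unset Printing Implicit Defensive.

Import Order.TTheory GRing.Theory Num.Theory.
Import numFieldNormedType.Exports.

Local Open Scope classical_set_scope.
Local Open Scope ring_scope.
Local Open Scope convex_scope.

(** * Compactness, saturation and sobriety *)

Lemma specialization_le_anti (X : topologicalType) (x y : X) :
  kolmogorov_space X -> specialization_le x y -> specialization_le y x -> x = y.
Proof.
move=> T0 xy yx; apply: contrapT => /eqP /T0 [A [[]|[]]];
  rewrite !inE => + nA; rewrite nbhsE => -[U [oU Ux] UA].
- by apply: nA; apply: UA; exact: xy.
- by apply: nA; apply: UA; exact: yx.
Qed.

Definition saturated (X : topologicalType) (A : set X) :=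
  forall x y, specialization_le x y -> A x -> A y.

Definition filtered (X : Type) (F : set (set X)) :=
  F !=set0 /\ forall A B, F A -> F B -> exists2 C, F C & C `<=` A `&` B.

(** Filteredness is asked for only within [K]: the family may then consist of
    sublevels of functions that are comparable on [K] but not elsewhere. *)
Lemma compact_filtered_closed (X : topologicalType) (K : set X)
    (F : set (set X)) :
  compact K -> F !=set0 ->
  (forall A B, F A -> F B -> exists2 C, F C & K `&` C `<=` A `&` B) ->
  (forall A, F A -> closed A) ->
  (forall A, F A -> K `&` A !=set0) -> K `&` \bigcap_(A in F) A !=set0.
Proof.
move=> cK [A0 FA0] Ffil Fcl FK.
have PF : ProperFilter (filter_from F (fun A => K `&` A)).
  apply: filter_from_proper => //; apply: filter_from_filter; first by exists A0.
  move=> A B FA FB; have [C FC CAB] := Ffil _ _ FA FB; exists C => //.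
  by move=> x KCx; have [Ax Bx] := CAB x KCx; case: KCx.
have [|x [Kx clx]] := cK _ PF; first by exists A0 => // x [].
exists x; split=> // A FA; apply: (Fcl _ FA) => V Vx.
have [|y [[Ky Ay] Vy]] := clx (K `&` A) V _ Vx; first by exists A.
by exists y.
Qed.

(** Sobriety makes a space well-filtered.  Among the closed sets that meet
    every member of [F] there is a minimal one, by compactness and Zorn's lemma;
    minimality and filteredness make it irreducible, and its generic point lies
    below a point of each member of [F]. *)
Lemma sober_well_filtered (X : topologicalType) (F : set (set X)) (C : set X) :
  sober X -> filtered F -> (forall K, F K -> compact K) ->
  (forall K, F K -> saturated K) -> closed C ->
  (forall K, F K -> K `&` C !=set0) -> C `&` \bigcap_(K in F) K !=set0.
Proof.
move=> [_ sobX] [[K0 FK0] Ffil] Fc Fs clC FC.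
pose P (U : set X) := open U /\ forall K, F K -> K `&` (C `\` U) !=set0.
have chainP (G : set (set X)) :
    G `<=` P -> total_on G subset -> P (\bigcup_(U in G) U).
  move=> GP Gtot; split; first by apply: bigcup_open => U /GP[].
  move=> K FK; have [->|/set0P[U0 GU0]] := eqVneq G set0.
    by rewrite bigcup_set0 setD0; exact: FC.
  have [||D [U GU <-]|D [U GU <-]|x [Kx Fx]] :=
      @compact_filtered_closed X K [set C `\` U | U in G] (Fc _ FK).
  - by exists (C `\` U0), U0.
  - move=> _ _ [U GU <-] [V GV <-].
    have [UV|VU] := Gtot _ _ GU GV.
      exists (C `\` V); first by exists V.
      by move=> x [_ [Cx nVx]]; split; split => // /UV.
    exists (C `\` U); first by exists U.
    by move=> x [_ [Cx nUx]]; split; split => // /VU.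
  - rewrite setDE; apply: closedI => //; apply: open_closedC.
    by have [] := GP _ GU.
  - by have [_] := GP _ GU; exact.
  - exists x; split=> //; split; first by have [] := Fx (C `\` U0) (ex_intro2 _ _ _ GU0 erefl).
    by case=> U GU Ux; have [_] := Fx (C `\` U) (ex_intro2 _ _ _ GU erefl).
have [U [[oU UF] maxU]] := Zorn_bigcup chainP.
pose Z := C `\` U.
have clZ : closed Z by rewrite /Z setDE; apply: closedI => //; exact: open_closedC.
(* Otherwise [U `|` ~` A] would be a larger element of [P]. *)
have smaller A : closed A -> ~ Z `<=` A -> exists2 K, F K & K `&` (Z `&` A) = set0.
  move=> clA nZA; apply: contrapT => noK; apply: (maxU (U `|` ~` A)).
    split; first by left.
    move=> AU; apply: nZA => x [Cx nUx]; apply: contrapT => nAx.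
    by apply: nUx; apply: AU; right.
  split; first by apply: openU => //; exact: closed_openC.
  move=> K FK; apply: contrapT => /set0P/negP/negPn/eqP K0'; apply: noK.
  exists K => //; apply/seteqP; split=> // x [Kx [[Cx nUx] Ax]].
  by rewrite -[set0]K0'; split => //; split => // -[].
have [|x Zx] := sobX Z.
  split => //; first by have [x [_ Zx]] := UF _ FK0; exists x.
  move=> A B clA clB ZAB; apply: contrapT => /not_orP[nA nB].
  have [K FK KA] := smaller _ clA nA; have [L FL LB] := smaller _ clB nB.
  have [M FM MKL] := Ffil _ _ FK FL.
  have [y [My Zy]] := UF _ FM; have [Ky Ly] := MKL _ My.
  by have [Ay|By] := ZAB y Zy; [have : set0 y by rewrite -KA | have : set0 y by rewrite -LB].
exists x; split.
  have : Z x by rewrite Zx; exact: subset_closure.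
  by case.
move=> K FK; have [y [Ky]] := UF _ FK; rewrite -/Z Zx => yx.
apply: (Fs _ FK y) => // V oV Vy.
by have [z [-> //]] := yx V (open_nbhs_nbhs (conj oV Vy)).
Qed.

(** The filter-based definition of compactness applies to each member of [F],
    so that the closed set of cluster points meets them all. *)
Lemma compact_bigcap_filtered (X : topologicalType) (F : set (set X)) :
  sober X -> filtered F -> (forall K, F K -> compact K) ->
  (forall K, F K -> saturated K) -> compact (\bigcap_(K in F) K).
Proof.
move=> sobX Ffil Fc Fs G PG GF.
have [||x [clx Fx]] :=
    @sober_well_filtered X F (cluster G) sobX Ffil Fc Fs.
- by rewrite clusterE; apply: closed_bigI => A _; exact: closed_closure.
- by move=> K FK; apply: Fc => //; apply: filterS GF => x; exact.
- by exists x.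
Qed.

(** A filter on [K] is traded for the filter of the points of [S] below its
    members.  Open sets are upward closed, so that a cluster point of the latter
    is one of the former. *)
Lemma compact_upward (X : topologicalType) (S K : set X) :
  compact S -> S `<=` K ->
  (forall x, K x -> exists2 y, S y & specialization_le y x) -> compact K.
Proof.
move=> cS SK below F PF FK.
pose down (A : set X) := [set y | S y /\ exists2 x, (A `&` K) x & specialization_le y x].
have PG : ProperFilter (filter_from F down).
  apply: filter_from_proper.
    apply: filter_from_filter; first by exists setT; exact: filterT.
    move=> A B FA FB; exists (A `&` B); first exact: filterI.
    by move=> y [Sy [x [[Ax Bx] Kx] yx]]; split; split=> //; exists x.
  move=> A FA; have [x [Ax Kx]] := @filter_ex _ F _ _ (filterI FA FK).
  by have [y Sy yx] := below _ Kx; exists y; split => //; exists x.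
have [|y [Sy cly]] := cS _ PG; first by exists setT; [exact: filterT|move=> y []].
exists y; split; first exact: SK.
move=> A V FA; rewrite nbhsE => -[U [oU Uy] UV].
have [||z [[Sz [x [Ax Kx] zx]] Uz]] := cly (down A) U.
- by exists A.
- exact: open_nbhs_nbhs.
- by exists x; split => //; apply: UV; exact: zx.
Qed.

Lemma compact_least (X : topologicalType) (bot : X) :
  least bot -> compact [set: X].
Proof.
move=> lb; apply: (@compact_upward _ [set bot]) => //.
  exact: compact_set1.
by move=> x _; exists bot => //; exact: lb.
Qed.

(** * Transport between finite weighted families *)

Section transport.
Context {R : realType}.

Lemma sum_setU_setI (T : finType) (f : T -> R) (A B : {set T}) :
  \sum_(x in A :|: B) f x + \sum_(x in A :&: B) f x =
  \sum_(x in A) f x + \sum_(x in B) f x.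
Proof.
rewrite ![\sum_(x in _) _]big_mkcond -!big_split; apply: eq_bigr => x _ /=.
by rewrite !inE; case: (x \in A); case: (x \in B) => /=; rewrite ?addr0 ?add0r.
Qed.

Lemma ler_sum_subset (T : finType) (f : T -> R) (A B : {set T}) :
  (forall x, 0 <= f x) -> A \subset B ->
  \sum_(x in A) f x <= \sum_(x in B) f x.
Proof.
move=> f0 /fintype.subsetP AB; rewrite ![\sum_(x in _) _]big_mkcond; apply: ler_sum => x _.
by case: ifPn => [/AB ->//|_]; case: ifP.
Qed.

Lemma sum_sub_point (T : finType) (f : T -> R) (z : T) (x : R) (A : {set T}) :
  \sum_(y in A) (f y - x *+ (y == z)) = \sum_(y in A) f y - x *+ (z \in A).
Proof.
rewrite sumrB; congr (_ - _); rewrite big_mkcond (bigD1 z) //= eqxx.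
rewrite big1 ?addr0 => [|y /negbTE ->]; first by case: ifP.
by case: ifP.
Qed.

Definition neighbours (S T : finType) (e : S -> T -> bool) (I : {set S}) :=
  [set k | [exists i in I, e i k]]%SET.

(** Remove one edge [(i0, k0)] and send along it the least amount [x] that the
    demand condition for the remaining edges allows.  That this amount is
    available is the modularity of the sums against the inclusions
    [N (I :|: J) = N I :|: N J] and [N (I :&: J) \subset N I :&: N J]. *)
Lemma transport (S T : finType) (e : S -> T -> bool) (a : S -> R) (c : T -> R) :
  (forall i, 0 <= a i) -> (forall k, 0 <= c k) ->
  (forall I : {set S}, \sum_(i in I) a i <= \sum_(k in neighbours e I) c k) ->
  exists t : S -> T -> R,
    [/\ forall i k, 0 <= t i k, forall i k, ~~ e i k -> t i k = 0,
        forall i, \sum_k t i k = a i & forall k, \sum_i t i k <= c k].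
Proof.
have [n] := ubnP #|[set p : S * T | e p.1 p.2]%SET|.
elim: n e a c => // n IH e a c lee a0 c0 hall.
case: (pickP [pred p : S * T | e p.1 p.2]) => [[i0 k0] /= eik|none]; last first.
  exists (fun _ _ => 0); split=> // [i|k]; last by rewrite big1.
  rewrite big1 //; apply/esym/le_anti; rewrite a0 andbT.
  have := hall [set i]%SET; rewrite big_set1 [X in _ <= X]big1 // => k.
  by rewrite inE => /exists_inP[j _ ejk]; have := none (j, k); rewrite /= ejk.
pose e' i k := e i k && ((i, k) != (i0, k0)).
pose N := neighbours e; pose N' := neighbours e'.
have N'N I : N' I \subset N I.
  apply/fintype.subsetP => k; rewrite !inE => /exists_inP[i iI /andP[eik' _]].
  by apply/exists_inP; exists i.
have NN' I k : k \in N I -> (k != k0) || (i0 \notin I) -> k \in N' I.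
  rewrite !inE => /exists_inP[i iI eik'] kI; apply/exists_inP; exists i => //.
  rewrite /e' eik' /= xpair_eqE negb_and orbC; case/orP: kI => [->//|i0I].
  by apply/orP; right; apply: contraNneq i0I => <-.
pose low (I : {set S}) := \sum_(i in I) a i - \sum_(k in N' I) c k.
pose x := \big[Num.max/0]_(I : {set S} | (i0 \in I) && (k0 \notin N' I)) low I.
have x0 : 0 <= x by exact: bigmax_ge_id.
have xc : x <= c k0.
  apply/bigmax_leP; split=> // I /andP[i0I k0I]; rewrite /low lerBlDr.
  apply: (le_trans (hall I)).
  have -> : c k0 = \sum_(k in [set k0]%SET) c k by rewrite big_set1.
  rewrite -sum_setU_setI ler_wpDr ?sumr_ge0 //; apply: ler_sum_subset => //.
  apply/fintype.subsetP => k kI; rewrite finset.in_setU finset.in_set1.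
  by case: (eqVneq k k0) => //= kk0; apply: NN' => //; rewrite kk0.
have xa : x <= a i0.
  apply/bigmax_leP; split=> // I /andP[i0I k0I]; rewrite /low lerBlDr.
  rewrite (bigD1 i0) //= lerD2l.
  have -> : \sum_(i in I | i != i0) a i = \sum_(i in I :\ i0) a i.
    by apply: eq_bigl => i; rewrite !inE andbC.
  apply: (le_trans (hall _)); apply: ler_sum_subset => //; apply/fintype.subsetP => k.
  rewrite !inE => /exists_inP[i]; rewrite !inE => /andP[ii0 iI] eik'.
  by apply/exists_inP; exists i => //; rewrite /e' eik' /= xpair_eqE (negbTE ii0).
(* The one comparison of bounds that combines two sets of demands. *)
have xJ (J : {set S}) : i0 \notin J -> k0 \in N J ->
    x <= \sum_(k in N J) c k - \sum_(i in J) a i.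
  move=> i0J k0J; apply/bigmax_leP; split; first by rewrite subr_ge0.
  move=> I /andP[i0I k0I]; rewrite /low lerBlDr addrAC lerBrDr.
  rewrite -(sum_setU_setI a) -(sum_setU_setI c).
  rewrite lerD //; apply: (le_trans (hall _)); apply: ler_sum_subset => //.
    apply/fintype.subsetP => k; rewrite inE => /exists_inP[i].
    rewrite finset.in_setU => iIJ eik'; rewrite finset.in_setU.
    case: (eqVneq k k0) => [->|kk0]; first by rewrite k0J.
    case/orP: iIJ => [iI|iJ]; apply/orP; [right|left]; last first.
      by rewrite inE; apply/exists_inP; exists i.
    by apply: NN'; rewrite ?kk0 // inE; apply/exists_inP; exists i.
  apply/fintype.subsetP => k; rewrite inE => /exists_inP[i].
  rewrite finset.in_setI => /andP[iI iJ] eik'; rewrite finset.in_setI.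
  have kJ : k \in N J by rewrite inE; apply/exists_inP; exists i.
  rewrite kJ inE; apply/exists_inP; exists i => //.
  rewrite /e' eik' xpair_eqE negb_and /=; apply/orP; left.
  by apply: contraNneq i0J => <-.
pose a' i := a i - x *+ (i == i0); pose c' k := c k - x *+ (k == k0).
have [||||t [t0 te ta tc]] := IH e' a' c'.
- rewrite -ltnS; apply: leq_trans lee; rewrite ltnS; apply: proper_card.
  apply/fintype.properP; split.
    by apply/fintype.subsetP => p; rewrite !inE => /andP[].
  by exists (i0, k0); rewrite !inE /= ?eik // /e' eqxx andbF.
- by move=> i; rewrite /a'; case: eqP => [->|_]; rewrite ?subr_ge0 ?mulr1n ?mulr0n ?subr0.
- by move=> k; rewrite /c'; case: eqP => [->|_]; rewrite ?subr_ge0 ?mulr1n ?mulr0n ?subr0.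
- move=> I; rewrite !sum_sub_point -/(N' I).
  have NIE : (i0 \notin I) || (k0 \in N' I) -> N I \subset N' I.
    move=> h; apply/fintype.subsetP => k kI; case: (eqVneq k k0) kI h => [->|kk0] kI.
      by case/orP => // ?; apply: NN' => //; apply/orP; right.
    by move=> _; apply: NN' => //; rewrite kk0.
  case: (boolP (i0 \in I)) NIE => [i0I|i0I] /= NIE.
    case: (boolP (k0 \in N' I)) NIE => [k0I|k0I] /= NIE.
      rewrite lerD2r; apply: (le_trans (hall I)).
      by apply: ler_sum_subset => //; exact: NIE.
    rewrite subr0 lerBlDl -lerBlDr.
    by apply: (le_bigmax_cond _ (low)); rewrite i0I.
  rewrite subr0; case: (boolP (k0 \in N' I)) NIE => [k0I|k0I] /= NIE.
    have -> : N' I = N I by apply/eqP; rewrite finset.eqEsubset N'N NIE.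
    rewrite lerBrDl -lerBrDr; apply: xJ => //.
    exact: (fintype.subsetP (N'N I)).
  rewrite subr0; apply: (le_trans (hall I)).
  by apply: ler_sum_subset => //; exact: NIE.
exists (fun i k => t i k + x *+ ((i == i0) && (k == k0))); split.
- by move=> i k; rewrite addr_ge0 // mulrn_wge0.
- move=> i k nik; rewrite te ?add0r; last by rewrite /e' (negbTE nik).
  case: (eqVneq i i0) nik => [->|_ _]; last by rewrite mulr0n.
  by case: (eqVneq k k0) => [->|_ _]; [rewrite eik|rewrite mulr0n].
- move=> i; rewrite big_split /= ta /a'; case: eqP => [->|_] /=.
    rewrite (bigD1 k0) //= eqxx big1 => [|k /negbTE -> //].
    by rewrite addr0 /= subrK.
  by rewrite big1 // subr0 addr0.
- move=> k; rewrite big_split /= -lerBrDr; apply: (le_trans (tc k)); rewrite /c'.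
  rewrite lerD2l lerN2; case: eqP => _.
    by rewrite (bigD1 i0) //= eqxx big1 ?addr0 // => i /negbTE ->.
  by rewrite big1 // => i _; rewrite andbF.
Qed.

End transport.

(** * Splitting a valuation along an open set *)

Section ereal_lemmas.
Context {R : realType}.
Implicit Types (x y : \bar R).
Local Open Scope ereal_scope.

Lemma lt_real_between x y : x < y -> exists2 r : R, x < r%:E & r%:E < y.
Proof.
case: x y => [x| |] [y| |] //.
- rewrite lte_fin => xy; exists ((x + y) / 2)%R; rewrite lte_fin; lra.
- by move=> _; exists (x + 1)%R; rewrite ?ltry // lte_fin ltrDl.
- by move=> _; exists (y - 1)%R; rewrite ?ltNyr // lte_fin ltrBlDr ltrDl.
- by move=> _; exists 0%R; rewrite ?ltNyr ?ltry.
Qed.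

Lemma lee_real_lt x y : (forall r : R, r%:E < x -> r%:E <= y) -> x <= y.
Proof.
move=> h; rewrite leNgt; apply/negP => /lt_real_between[r yr /h].
by rewrite leNgt yr.
Qed.

Lemma lt_realD_split x y (r : R) : 0 <= x -> 0 <= y -> r%:E < x + y ->
  exists s t : R, [/\ s%:E < x, t%:E < y & r = (s + t)%R].
Proof.
case: x y => [x| |] [y| |] // _ _.
- rewrite -EFinD lte_fin => h; exists (r - y + (x + y - r) / 2)%R.
  exists (y - (x + y - r) / 2)%R; rewrite !lte_fin; split; lra.
- move=> _; exists (x - 1)%R, (r - x + 1)%R; rewrite ltry lte_fin; split => //; lra.
- move=> _; exists (r - y + 1)%R, (y - 1)%R; rewrite ltry lte_fin; split => //; lra.
- by move=> _; exists r, 0%R; rewrite !ltry addr0.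
Qed.

Lemma ereal_supD_le (S T : set \bar R) x : S !=set0 -> T !=set0 ->
  (forall s, S s -> 0 <= s) -> (forall t, T t -> 0 <= t) ->
  (forall s t, S s -> T t -> s + t <= x) -> ereal_sup S + ereal_sup T <= x.
Proof.
move=> [s0 Ss0] [t0 Tt0] S0 T0 ST; apply: lee_real_lt => r.
have sS : 0 <= ereal_sup S by exact: (le_trans (S0 _ Ss0) (ereal_sup_ubound Ss0)).
have sT : 0 <= ereal_sup T by exact: (le_trans (T0 _ Tt0) (ereal_sup_ubound Tt0)).
move=> /(lt_realD_split sS sT)[s [t [/ereal_sup_gt[s' Ss' ss'] /ereal_sup_gt[t' Tt' tt'] ->]]].
by rewrite EFinD (le_trans _ (ST _ _ Ss' Tt')) // leeD // ltW.
Qed.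

End ereal_lemmas.

Section split.
Context {R : realType} {X : topologicalType}.
Implicit Types U V A : opens X.
Local Open Scope ereal_scope.

Lemma opens_ext U V : (U : set X) = V -> U = V.
Proof.
by case: U V => [U oU] [V oV] /= UV; subst V; congr Opens; exact: Prop_irrelevance.
Qed.

Lemma opensP U V : (forall x, (U : set X) x <-> (V : set X) x) -> U = V.
Proof. by move=> h; apply: opens_ext; apply/seteqP; split=> x /h. Qed.

Lemma valuation_subadditive (nu : valuation R X) U V :
  nu (opensU U V) <= nu U + nu V.
Proof. by rewrite valuation_modular leeDl // valuation_ge0. Qed.

Section restriction.
Variables (nu : valuation R X) (E : opens X).

Definition restriction : valuation R X.
Proof.
apply: (@Valuation _ _ (fun U => nu (opensI U E))).
- by move=> U; exact: valuation_ge0.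
- by rewrite -(valuation0 nu); congr (nu _); apply: opensP => x /=; split=> [[]|].
- move=> U V; rewrite valuation_modular; congr (nu _ + nu _); apply: opensP => x /=; tauto.
- by move=> U V UV; apply: valuation_monotone => x /= [/UV].
- move=> D [[U0 DU0] Ddir].
  pose D' := [set opensI U E | U in D].
  have -> : opensI (opens_bigcup D) E = opens_bigcup D'.
    apply: opensP => x /=; split=> [[[U DU Ux] Ex]|[_ [U DU <-] [Ux Ex]]].
      by exists (opensI U E) => //; exists U.
    by split=> //; exists U.
  rewrite valuation_scott ?image_comp //; split; first by exists (opensI U0 E), U0.
  move=> _ _ [U DU <-] [V DV <-]; have [W [DW UW VW]] := Ddir _ _ DU DV.
  exists (opensI W E); split; first by exists W.
    by move=> x /= [/UW].
  by move=> x /= [/VW].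
Defined.

(** Among the opens [A] whose intersection with [E] has finite mass, [res A U] is
    the mass of [A `&` U] outside of [E]: it is [nu (A `&` (U `|` E)) - nu (A `&` E)],
    which depends on [U] through a single value of [nu], so that modularity and
    Scott continuity in [U] are inherited from [nu]. *)
Let small A := nu (opensI A E) < +oo.
Let res A U := nu (opensI A (opensU U E)) - nu (opensI A E).

Let small_fin A : small A -> nu (opensI A E) \is a fin_num.
Proof. by move=> sA; rewrite ge0_fin_numE // valuation_ge0. Qed.

Let small0 : small opens0.
Proof.
rewrite /small (_ : opensI _ _ = opens0) ?valuation0 ?ltry //.
by apply: opensP => x /=; split=> [[]|].
Qed.

Let smallU A A' : small A -> small A' -> small (opensU A A').
Proof.
move=> sA sA'; rewrite /small (_ : opensI _ _ = opensU (opensI A E) (opensI A' E)).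
  by rewrite (le_lt_trans (valuation_subadditive _ _ _)) // lte_add_pinfty.
by apply: opensP => x /=; tauto.
Qed.

Let res_ge0 A U : small A -> 0 <= res A U.
Proof.
move=> sA; rewrite /res sube_ge0; last by rewrite small_fin ?orbT.
by apply: valuation_monotone => x /= [Ax Ex]; split => //; right.
Qed.

Let res_mono A U V : small A -> U `<=` V -> res A U <= res A V.
Proof.
move=> sA UV; rewrite /res leeB //; apply: valuation_monotone.
by move=> x /= [Ax [/UV Vx|Ex]]; split => //; [left|right].
Qed.

Let res_index_mono A A' U : small A -> small A' -> A `<=` A' ->
  res A U <= res A' U.
Proof.
move=> sA sA' AA'; rewrite /res leeBrDr ?small_fin // -addeAC leeBlDr ?small_fin //.
rewrite valuation_modular leeD //; apply: valuation_monotone => x /=.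
  by case=> [[/AA' A'x]|] //; tauto.
tauto.
Qed.

Let res_modular A U V : small A ->
  res A U + res A V = res A (opensU U V) + res A (opensI U V).
Proof.
move=> sA; rewrite /res addeACA valuation_modular [RHS]addeACA.
congr (nu _ + nu _ + _).
  by apply: opensP => x /=; tauto.
by apply: opensP => x /=; tauto.
Qed.

Let res_above A U : small A -> small U -> U `<=` A ->
  res A U = nu U - nu (opensI U E).
Proof.
move=> sA sU UA; rewrite /res.
have UE : (nu U + nu (opensI A E) =
    nu (opensI A (opensU U E)) + nu (opensI U E)).
  rewrite valuation_modular; congr (nu _ + nu _); apply: opensP => x /=.
    split=> [[Ux|[Ax Ex]]|[Ax [Ux|Ex]]]; [|tauto|tauto|tauto].
    by split; [exact: UA|left].
  by split=> [[Ux [_ Ex]]|[Ux Ex]] //; split=> //; split=> //; exact: UA.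
apply/eqP; rewrite eq_le; apply/andP; split.
  by rewrite leeBlDr ?small_fin // addeAC leeBrDr ?small_fin // UE.
by rewrite leeBrDr ?small_fin // addeAC leeBlDr ?small_fin // UE.
Qed.

(** For growing [A] the [res A] form a directed family of valuations. *)
Let rem U := ereal_sup [set res A U | A in small].

Let rem_ub A U : small A -> res A U <= rem U.
Proof. by move=> sA; apply: ereal_sup_ubound; exists A. Qed.

Let rem_mono U V : U `<=` V -> rem U <= rem V.
Proof.
move=> UV; apply: ge_ereal_sup => _ [A sA <-].
exact: (le_trans (res_mono sA UV) (rem_ub _ sA)).
Qed.

Let rem_ge0 U : 0 <= rem U.
Proof. exact: (le_trans (res_ge0 U small0) (rem_ub _ small0)). Qed.

Definition corestriction : valuation R X.
Proof.
apply: (@Valuation _ _ rem) => //.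
- apply/eqP; rewrite eq_le rem_ge0 andbT; apply: ge_ereal_sup => _ [A sA <-].
  rewrite /res (_ : opensI A (opensU _ _) = opensI A E) ?subee ?small_fin //.
  by apply: opensP => x /=; tauto.
- move=> U V; apply/eqP; rewrite eq_le; apply/andP; split.
    apply: ereal_supD_le.
    + by exists (res opens0 U), opens0.
    + by exists (res opens0 V), opens0.
    + by move=> _ [A sA <-]; exact: res_ge0.
    + by move=> _ [A sA <-]; exact: res_ge0.
    move=> _ _ [A sA <-] [A' sA' <-]; have sAA' := smallU sA sA'.
    apply: (@le_trans _ _ (res (opensU A A') U + res (opensU A A') V)).
      by rewrite leeD // res_index_mono // => x; [left|right].
    by rewrite res_modular // leeD // rem_ub.
  apply: ereal_supD_le.
  + by exists (res opens0 (opensU U V)), opens0.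
  + by exists (res opens0 (opensI U V)), opens0.
  + by move=> _ [A sA <-]; exact: res_ge0.
  + by move=> _ [A sA <-]; exact: res_ge0.
  move=> _ _ [A sA <-] [A' sA' <-]; have sAA' := smallU sA sA'.
  apply: (@le_trans _ _ (res (opensU A A') (opensU U V) + res (opensU A A') (opensI U V))).
    by rewrite leeD // res_index_mono // => x; [left|right].
  by rewrite -res_modular // leeD // rem_ub.
- move=> D [[U0 DU0] Ddir]; apply/eqP; rewrite eq_le; apply/andP; split.
    apply: ge_ereal_sup => _ [A sA <-].
    rewrite /res leeBlDr ?small_fin //.
    pose D' := [set opensI A (opensU U E) | U in D].
    have -> : opensI A (opensU (opens_bigcup D) E) = opens_bigcup D'.
      apply: opensP => x /=; split=> [[Ax [[U DU Ux]|Ex]]|[_ [U DU <-] [Ax [Ux|Ex]]]].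
      - by exists (opensI A (opensU U E)); [exists U|split=> //; left].
      - by exists (opensI A (opensU U0 E)); [exists U0|split=> //; right].
      - by split=> //; left; exists U.
      - by split=> //; right.
    rewrite valuation_scott; last first.
      split; first by exists (opensI A (opensU U0 E)), U0.
      move=> _ _ [U DU <-] [V DV <-]; have [W [DW UW VW]] := Ddir _ _ DU DV.
      exists (opensI A (opensU W E)); split; first by exists W.
        by move=> x /= [Ax [/UW Wx|Ex]]; split=> //; [left|right].
      by move=> x /= [Ax [/VW Wx|Ex]]; split=> //; [left|right].
    apply: ge_ereal_sup => _ [_ [U DU <-] <-].
    rewrite -leeBlDr ?small_fin //.
    by apply: (le_trans (rem_ub U sA)); apply: ereal_sup_ubound; exists U.
  by apply: ge_ereal_sup => _ [U DU <-]; apply: rem_mono => x Ux; exists U.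
Defined.

(** Masses inside and outside of [E].  On opens that meet [E] in infinite mass
    the outer part is not a difference; it is recovered as the supremum over the
    smaller opens on which it is one. *)
Lemma valuation_split U : nu U = restriction U + corestriction U.
Proof.
rewrite /=; have [UE|UE] := boolP (nu (opensI U E) == +oo).
  have UEU : nu (opensI U E) <= nu U by apply: valuation_monotone => x [].
  move: UEU; rewrite (eqP UE) leye_eq => /eqP ->.
  by rewrite addye // gt_eqF // (lt_le_trans _ (rem_ge0 U)) ?ltNyr.
have sU : small U by rewrite /small ltey.
have -> : rem U = nu U - nu (opensI U E).
  apply/eqP; rewrite eq_le; apply/andP; split.
    apply: ge_ereal_sup => _ [A sA <-].
    rewrite -(@res_above (opensU A U)) //; last 2 first.
    + exact: smallU.
    + by move=> x; right.
    apply: res_index_mono => //; first exact: smallU.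
    by move=> x; left.
  by rewrite -(@res_above U) // rem_ub.
by rewrite addeC subeK // small_fin.
Qed.

Lemma corestrictionU U : corestriction (opensU E U) = corestriction U.
Proof.
rewrite /= /rem; congr ereal_sup; apply: eq_imagel => A _; congr (nu _ - _).
by apply: opensP => x /=; tauto.
Qed.

Lemma corestriction_support (O : opens X) :
  (forall U, nu U = nu (opensI U O)) ->
  forall U, corestriction U = corestriction (opensI U O).
Proof.
move=> nuO U; rewrite /= /rem; congr ereal_sup; apply: eq_imagel => A _.
congr (_ - _); rewrite nuO [RHS]nuO; congr (nu _).
by apply: opensP => x /=; tauto.
Qed.

End restriction.

End split.

(** * Approximation by weighted convex compact sets *)

Section approximants.
Context {R : realType} {B : topConvType R}.
Implicit Types (O U : opens B) (nu : valuation R B).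

(** Measures are bounded from below through the open part of a brick, and values
    of functions through its compact convex part. *)
Record brick (O : set B) := Brick {
  brick_open : opens B;
  brick_set : set B;
  brick_compact : compact brick_set;
  brick_convex : convex_subset brick_set;
  brick_open_sub : brick_open `<=` brick_set;
  brick_sub : brick_set `<=` O }.

(** The formal sum of the [weight i] times a point mass smeared over
    [brick_set (ap_brick i)]. *)
Record approximant (O : set B) := Approximant {
  ap_index :> finType;
  weight : ap_index -> R;
  weight_gt0 : forall i, 0 < weight i;
  ap_brick : ap_index -> brick O }.

Definition ap_open O (xi : approximant O) (i : xi) : opens B :=
  brick_open (ap_brick i).
Definition ap_set O (xi : approximant O) (i : xi) : set B :=
  brick_set (ap_brick i).
Definition mass O (xi : approximant O) : R := \sum_(i : xi) weight i.

Lemma mass_ge0 O (xi : approximant O) : 0 <= mass xi.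
Proof. by apply: sumr_ge0 => i _; exact/ltW/weight_gt0. Qed.

Definition opens_cover (T : finType) (V : T -> opens B) (I : {set T}) : opens B :=
  opens_bigcup [set V i | i in [set i | i \in I]].

Lemma opens_coverP (T : finType) (V : T -> opens B) (I : {set T}) x :
  (opens_cover V I : set B) x <-> exists2 i, i \in I & (V i : set B) x.
Proof.
split=> [[_ [i iI <-] Vix]|[i iI Vix]]; first by exists i.
by exists (V i) => //; exists i.
Qed.

(** The bricks may overlap, whence one condition for each subfamily.  Strictness
    makes this a weakly open condition on [nu]. *)
Definition way_below O (xi : approximant O) nu :=
  forall I : {set xi}, I != finset.set0 ->
    ((\sum_(i in I) weight i)%:E < nu (opens_cover (@ap_open O xi) I))%E.

Lemma way_below_le O (xi : approximant O) nu (I : {set xi}) :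
  way_below xi nu ->
  ((\sum_(i in I) weight i)%:E <= nu (opens_cover (@ap_open O xi) I))%E.
Proof.
move=> xnu; have [->|/xnu/ltW//] := eqVneq I finset.set0.
by rewrite big_set0 valuation_ge0.
Qed.

Lemma way_below_mono O (xi : approximant O) nu nu' :
  (forall U, nu U <= nu' U)%E -> way_below xi nu -> way_below xi nu'.
Proof. by move=> nn' xnu I /xnu I0; exact: lt_le_trans I0 (nn' _). Qed.

Definition ap_widen O O' (OO' : O `<=` O') (xi : approximant O) : approximant O' :=
  @Approximant O' xi (@weight _ xi) (@weight_gt0 _ xi) (fun i =>
    let b := ap_brick i in
    Brick (@brick_compact _ b) (@brick_convex _ b) (@brick_open_sub _ b)
      (subset_trans (@brick_sub _ b) OO')).

Lemma way_below_widen O O' (OO' : O `<=` O') (xi : approximant O) nu :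
  way_below xi nu -> way_below (ap_widen OO' xi) nu.
Proof. by move=> xnu I /xnu. Qed.

Definition ap_void O : approximant O :=
  @Approximant O void (fun i => match i with end) (fun i => match i with end)
    (fun i => match i with end).

Lemma way_below_void O nu : way_below (ap_void O) nu.
Proof. by move=> I /set0Pn[[]]. Qed.

Lemma mass_void O : mass (ap_void O) = 0.
Proof. by rewrite /mass big1 // => -[]. Qed.

Definition ap_single O (b : brick O) (c : R) (c0 : 0 < c) : approximant O :=
  @Approximant O unit (fun => c) (fun => c0) (fun => b).

Lemma mass_single O (b : brick O) c (c0 : 0 < c) : mass (ap_single b c0) = c.
Proof. by rewrite /mass big_const card_unit /= addr0. Qed.

Lemma way_below_single O (b : brick O) c (c0 : 0 < c) nu :
  (c%:E < nu (brick_open b))%E -> way_below (ap_single b c0) nu.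
Proof.
move=> cnu I /set0Pn[[] ttI]; rewrite (bigD1 tt) //= big1 ?addr0; last first.
  by move=> [] /andP[].
apply: (lt_le_trans cnu); apply: valuation_monotone => x bx.
by apply/opens_coverP; exists tt.
Qed.

Definition ap_sum O (xi zeta : approximant O) : approximant O :=
  @Approximant O (xi + zeta)%type
    (fun i => match i with inl i => weight i | inr i => weight i end)
    (fun i => match i with inl i => weight_gt0 i | inr i => weight_gt0 i end)
    (fun i => match i with inl i => ap_brick i | inr i => ap_brick i end).

Lemma mass_sum O (xi zeta : approximant O) :
  mass (ap_sum xi zeta) = mass xi + mass zeta.
Proof. by rewrite /mass big_sumType. Qed.

Lemma way_below_sum O (xi zeta : approximant O) nu nu1 nu2 :
  (forall U, nu U = nu1 U + nu2 U)%E -> way_below xi nu1 -> way_below zeta nu2 ->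
  way_below (ap_sum xi zeta) nu.
Proof.
move=> nuE xnu1 znu2 I I0.
pose I1 := [set i : xi | inl i \in I]%SET; pose I2 := [set i : zeta | inr i \in I]%SET.
have -> : \sum_(i in I) weight i =
    \sum_(i in I1) weight i + \sum_(i in I2) weight i.
  rewrite big_mkcond big_sumType [in RHS]big_mkcond [X in _ = _ + X]big_mkcond.
  by congr (_ + _); apply: eq_bigr => i _ /=; rewrite inE.
rewrite EFinD nuE; set U := opens_cover _ I.
have U1 : (nu1 (opens_cover (@ap_open _ xi) I1) <= nu1 U)%E.
  apply: valuation_monotone => x /opens_coverP[i]; rewrite inE => iI ix.
  by apply/opens_coverP; exists (inl i).
have U2 : (nu2 (opens_cover (@ap_open _ zeta) I2) <= nu2 U)%E.
  apply: valuation_monotone => x /opens_coverP[i]; rewrite inE => iI ix.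
  by apply/opens_coverP; exists (inr i).
have [I10|I10] := eqVneq I1 finset.set0; last first.
  rewrite lte_leD // ?(lt_le_trans _ U1) ?xnu1 //.
  by rewrite (le_trans _ U2) // way_below_le.
rewrite addeC [X in (_ < X)%E]addeC lte_leD // ?(le_trans _ U1) ?way_below_le //.
rewrite (lt_le_trans _ U2) // znu2 //.
have /set0Pn[[i|i] iI] := I0; last by apply/set0Pn; exists i; rewrite inE.
by have : i \in I1 by [rewrite inE]; rewrite I10 inE.
Qed.

Definition opens_seq O (l : seq (brick O)) : opens B :=
  foldr (fun b U => opensU (brick_open b) U) opens0 l.

Lemma opens_seq_cat O (l l' : seq (brick O)) :
  opens_seq (l ++ l') = opensU (opens_seq l) (opens_seq l').
Proof.
apply: opensP => x; elim: l => [|b l IH] /=; first by split=> [|[]//]; right.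
by rewrite IH /=; tauto.
Qed.

Local Open Scope ereal_scope.

Lemma mine_add_le (x y : \bar R) (M : R) : 0 <= x -> 0 <= y -> (0 <= M)%R ->
  Order.min (x + y) M%:E <= Order.min x M%:E + Order.min y M%:E.
Proof.
move=> x0 y0 M0; have [xM|xM] := leP x M%:E; have [yM|yM] := leP y M%:E.
- by rewrite ge_min lexx.
- by rewrite ge_min leeDr ?orbT.
- by rewrite ge_min leeDl ?orbT.
- by rewrite ge_min leeDl ?lee_fin ?orbT.
Qed.

(** A finite union of bricks is exhausted brick after brick: the mass of each
    one outside of its predecessors becomes its weight. *)
Lemma approx_opens_seq O (l : seq (brick O)) nu (e M : R) :
  (0 < e)%R -> (0 <= M)%R -> exists2 xi : approximant O, way_below xi nu &
    Order.min (nu (opens_seq l)) M%:E <= (mass xi + e)%:E.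
Proof.
elim: l nu e => [|b l IH] nu e e0 M0.
  exists (ap_void O); first exact: way_below_void.
  by rewrite mass_void /= valuation0 ge_min lee_fin add0r ltW.
have e20 : (0 < e / 2)%R by rewrite divr_gt0.
set V := brick_open b.
have [xi xnu mxi] := IH (corestriction nu V) _ e20 M0.
have nuE : nu (opens_seq (b :: l)) = nu V + corestriction nu V (opens_seq l).
  rewrite (valuation_split nu V) corestrictionU /=; congr (nu _ + _).
  by apply: opensP => x /=; tauto.
have corest U : corestriction nu V U <= nu U.
  by rewrite (valuation_split nu V U) leeDr // valuation_ge0.
have [V0|Vn0] := eqVneq (nu V) 0.
  exists xi; first exact: way_below_mono xnu.
  rewrite nuE V0 add0e; apply: (le_trans mxi); rewrite lee_fin; lra.
have Vgt0 : 0 < nu V by rewrite lt0e Vn0 valuation_ge0.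
(* Strictly below [nu V], positive, and within [e / 2] of it up to truncation. *)
have [c [c0 cV Vc]] : exists c : R,
    [/\ (0 < c)%R, c%:E < nu V & Order.min (nu V) M%:E <= (c + e / 2)%:E].
  move: (nu V) Vgt0 => [v| |] //.
    rewrite lte_fin => v0; exists (Num.max (v / 2) (v - e / 2))%R; split.
    - by rewrite lt_max divr_gt0.
    - rewrite lte_fin gt_max; apply/andP; split; lra.
    - rewrite ge_min lee_fin -lerBlDr le_max lexx ?orbT //.
  move=> _; exists (Num.max 1 M)%R; split; first by rewrite lt_max ltr01.
    by rewrite ltry.
  rewrite ge_min; apply/orP; right; rewrite lee_fin -lerBlDr le_max; apply/orP; right; lra.
exists (ap_sum (ap_single b c0) xi).
  apply: (@way_below_sum _ _ _ _ (restriction nu V) (corestriction nu V)) => //.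
  - exact: valuation_split.
  - apply: way_below_single => /=; apply: (lt_le_trans cV).
    by apply: valuation_monotone.
rewrite mass_sum mass_single nuE.
apply: (le_trans (mine_add_le _ _ M0)); rewrite ?valuation_ge0 //.
apply: (le_trans (leeD Vc mxi)); rewrite -EFinD lee_fin; lra.
Qed.

Hypothesis lcc : @locally_convex_compact R B.

Lemma opens_bigcup_seq O :
  O = opens_bigcup [set @opens_seq O l | l in [set: seq (brick O)]].
Proof.
apply: opensP => x; split=> [Ox|[_ [l _ <-]]].
  have [K [nK KO cK vK]] := lcc (open_nbhs_nbhs (conj (opens_open O) Ox)).
  pose V := Opens (@open_interior _ K).
  pose b := @Brick O V K cK vK (@interior_subset _ K) KO.
  by exists (opens_seq [:: b]); [exists [:: b]|left].
by elim: l => //= b l IH [/brick_open_sub/brick_sub|/IH].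
Qed.

(** By local convex-compactness the finite unions of bricks contained in [O] are
    a directed family with union [O]. *)
Lemma approx_open nu O (e M : R) : nu O = nu opensT -> (0 < e)%R -> (0 <= M)%R ->
  exists2 xi : approximant O, way_below xi nu &
    Order.min (nu opensT) M%:E <= (mass xi + e)%:E.
Proof.
move=> <- e0 M0; have e20 : (0 < e / 2)%R by rewrite divr_gt0.
have mfin : Order.min (nu O) M%:E \is a fin_num.
  rewrite ge0_fin_numE ?gt_min ?ltry ?orbT //.
  by rewrite le_min valuation_ge0 lee_fin.
have mO : Order.min (nu O) M%:E - (e / 2)%:E < nu O.
  apply: (@lt_le_trans _ _ (Order.min (nu O) M%:E)); last by rewrite ge_min lexx.
  by rewrite -(fineK mfin) -EFinB lte_fin; lra.
have dirO : directed_opens [set @opens_seq O l | l in [set: seq (brick O)]].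
  split; first by exists (@opens_seq O [::]), [::].
  move=> _ _ [l _ <-] [l' _ <-]; exists (opens_seq (l ++ l')); split.
  - by exists (l ++ l').
  - by rewrite opens_seq_cat => x; left.
  - by rewrite opens_seq_cat => x; right.
move: mO; rewrite {2}(opens_bigcup_seq O) valuation_scott // => /ereal_sup_gt.
move=> [_ [_ [l _ <-] <-] mO]; have [xi xnu mxi] := approx_opens_seq l nu e20 M0.
exists xi => //; move: mO; rewrite lteBlDr // => mO.
have : Order.min (nu O) M%:E <= Order.min (nu (opens_seq l)) M%:E + (e / 2)%:E.
  have [lM|lM] := leP (nu (opens_seq l)) M%:E; first exact: ltW.
  by rewrite ge_min leeDl ?orbT // lee_fin ltW.
move=> /le_trans; apply; apply: (le_trans (leeD mxi (lexx _))).
by rewrite -EFinD lee_fin; lra.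
Qed.

Definition captured (S : finType) (E : S -> opens B) O (xi : approximant O)
    (J : {set S}) : R :=
  (\sum_(i in neighbours (fun j (i : xi) => `[< ap_set i `<=` E j >]) J)
     weight i)%R.

Lemma captured_sum (S : finType) (E : S -> opens B) O (xi zeta : approximant O) J :
  captured E (ap_sum xi zeta) J = (captured E xi J + captured E zeta J)%R.
Proof.
rewrite /captured big_mkcond big_sumType [in RHS]big_mkcond [X in _ = (_ + X)%R]big_mkcond.
by congr (_ + _)%R; apply: eq_bigr => i _ /=; rewrite !inE.
Qed.

Lemma captured_mono (S : finType) (E : S -> opens B) O (xi : approximant O)
    (J J' : {set S}) :
  J \subset J' -> (captured E xi J <= captured E xi J')%R.
Proof.
move=> /fintype.subsetP JJ'; apply: ler_sum_subset => [i|].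
  exact/ltW/weight_gt0.
apply/fintype.subsetP => i; rewrite !inE => /exists_inP[j /JJ' jJ ij].
by apply/exists_inP; exists j.
Qed.

(** Split the valuation along the opens [E j] one after the other, so that every
    brick used for the part inside of [E j] is contained in [E j]. *)
Lemma approx_family_seq (S : finType) (E : S -> opens B) (s : seq S) nu O (e M : R) :
  (forall U, nu U = nu (opensI U O)) -> (0 < e)%R -> (0 <= M)%R ->
  exists xi : approximant O,
    [/\ way_below xi nu, Order.min (nu opensT) M%:E <= (mass xi + e)%:E &
      forall J : {set S}, {subset J <= s} ->
        Order.min (nu (opens_cover E J)) M%:E <= (captured E xi J + e)%:E].
Proof.
elim: s nu O e => [|i s IH] nu O e nuO e0 M0.
  have [|xi xnu mxi] := @approx_open nu O e M _ e0 M0.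
    by rewrite [RHS]nuO; congr (nu _); apply: opensP => x /=; tauto.
  exists xi; split => // J Js; have -> : J = finset.set0.
    by apply/setP => j; rewrite inE; apply/negP => /Js.
  rewrite (_ : opens_cover E finset.set0 = opens0); last first.
    by apply: opensP => x; split=> [/opens_coverP[j]|[]]; rewrite inE.
  rewrite valuation0 ge_min lee_fin addr_ge0 ?(ltW e0) // sumr_ge0 // => k _.
  exact/ltW/weight_gt0.
have e20 : (0 < e / 2)%R by rewrite divr_gt0.
have [|xi1 [xnu1 m1 c1]] := IH (restriction nu (E i)) (opensI O (E i)) _ _ e20 M0.
  move=> U /=; rewrite nuO; congr (nu _); apply: opensP => x /=; tauto.
have [|xi2 [xnu2 m2 c2]] := IH (corestriction nu (E i)) O _ _ e20 M0.
  exact: corestriction_support.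
have OE : opensI O (E i) `<=` O by move=> x [].
exists (ap_sum (ap_widen OE xi1) xi2); split.
- exact: way_below_sum (valuation_split nu (E i)) (way_below_widen xnu1) xnu2.
- rewrite mass_sum (valuation_split nu (E i)).
  apply: (le_trans (mine_add_le _ _ M0)); rewrite ?valuation_ge0 //.
  apply: (le_trans (leeD m1 m2)); rewrite -EFinD lee_fin addrACA -splitr.
  exact: lexx.
move=> J Js; rewrite captured_sum (valuation_split nu (E i)).
apply: (le_trans (mine_add_le _ _ M0)); rewrite ?valuation_ge0 //.
have [iJ|iJ] := boolP (i \in J); last first.
  have Js' : {subset J <= s}.
    by move=> j jJ; have := Js _ jJ; rewrite in_cons; case: eqP jJ iJ => // -> ->.
  apply: (le_trans (leeD (c1 _ Js') (c2 _ Js'))).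
  rewrite -EFinD lee_fin addrACA -splitr; exact: lexx.
have Js' : {subset J :\ i <= s}.
  move=> j; rewrite finset.in_setD1 => /andP[ji /Js].
  by rewrite in_cons (negbTE ji).
have JE : opens_cover E J = opensU (E i) (opens_cover E (J :\ i)).
  apply: opensP => x; split=> [/opens_coverP[j jJ Ejx]|[Eix|/opens_coverP[j]]].
  - have [ji|ji] := eqVneq j i; first by left; rewrite -ji.
    by right; apply/opens_coverP; exists j => //; rewrite finset.in_setD1 ji.
  - by apply/opens_coverP; exists i.
  - by rewrite finset.in_setD1 => /andP[_ jJ] Ejx; apply/opens_coverP; exists j.
have m1' : Order.min (restriction nu (E i) (opens_cover E J)) M%:E <= (mass xi1 + e / 2)%:E.
  apply: le_trans m1; rewrite le_min !ge_min lexx orbT andbT.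
  by rewrite valuation_monotone.
rewrite {2}JE corestrictionU.
apply: (le_trans (leeD m1' (c2 _ Js'))); rewrite -EFinD lee_fin.
have -> : captured E (ap_widen OE xi1) J = mass xi1.
  apply: eq_bigl => k; rewrite inE; apply/exists_inP; exists i => //.
  by apply/asboolP => x /(@brick_sub _ (@ap_brick _ xi1 k)) [].
by rewrite addrACA -splitr lerD2r lerD2l captured_mono // subD1set.
Qed.

(** The truncation at [M] allows a single approximant, of finite mass, to serve
    opens of infinite measure as well. *)
Lemma approx_family (S : finType) (E : S -> opens B) nu (e M : R) :
  (0 < e)%R -> (0 <= M)%R ->
  exists xi : approximant (@opensT B),
    [/\ way_below xi nu, Order.min (nu opensT) M%:E <= (mass xi + e)%:E &
      forall J : {set S},
        Order.min (nu (opens_cover E J)) M%:E <= (captured E xi J + e)%:E].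
Proof.
move=> e0 M0.
have [|xi [xnu mxi cxi]] := @approx_family_seq S E (enum S) nu opensT e M _ e0 M0.
  by move=> U; congr (nu _); apply: opensP => x /=; tauto.
by exists xi; split => // J; apply: cxi => j _; rewrite mem_enum.
Qed.

End approximants.

(** * Integration against a valuation *)

Section lsc_operations.
Context {R : realType} {X : topologicalType}.
Implicit Types (f g h : lscfun R X) (U : opens X).
Local Open Scope ereal_scope.

Definition lsc_add f g : lscfun R X.
Proof.
apply: (@LscFun _ _ (fun x => f x + g x)) => [x|x a /=].
  by rewrite adde_ge0 // lscfun_ge0.
move=> /(lt_realD_split (lscfun_ge0 _ _) (lscfun_ge0 _ _))[s [t [sf tg ->]]].
have [V xV Vf] := lscfun_lsc sf; have [W xW Wg] := lscfun_lsc tg.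
exists (V `&` W); first exact: filterI.
by move=> y [/Vf sfy /Wg tgy]; rewrite EFinD lteD.
Defined.

Definition lsc_step (d : R) (d0 : (0 <= d)%R) U : lscfun R X.
Proof.
apply: (@LscFun _ _ (fun x => if x \in (U : set X) then d%:E else 0)) => [x|x a /=].
  by case: ifP => // _; rewrite lee_fin.
have [xU|xU] := boolP (x \in (U : set X)) => ad.
  exists (U : set X); first by apply: open_nbhs_nbhs; split; [exact: opens_open|exact/set_mem].
  by move=> y /mem_set ->.
exists setT; first exact: filterT.
by move=> y _; apply: (lt_le_trans ad); case: ifP => // _; rewrite lee_fin.
Defined.

Definition lsc0 : lscfun R X.
Proof.
apply: (@LscFun _ _ (fun=> 0)) => // x a a0.
by exists setT; first exact: filterT.
Defined.

Lemma superlevel_anti h (s t : R) : (s <= t)%R -> superlevel h t `<=` superlevel h s.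
Proof. by move=> st x /=; apply: le_lt_trans; rewrite lee_fin. Qed.

Lemma superlevel_neg h (t : R) : (t < 0)%R -> superlevel h t = opensT.
Proof.
move=> t0; apply: opensP => x /=; split=> // _.
by rewrite (@lt_le_trans _ _ 0) ?lte_fin // lscfun_ge0.
Qed.

Lemma superlevel_step h d (d0 : (0 <= d)%R) U t :
  superlevel (lsc_add h (lsc_step d0 U)) t =
  opensU (superlevel h t) (opensI U (superlevel h (t - d))).
Proof.
apply: opensP => x /=; have [xU|xU] := boolP (x \in (U : set X)).
  rewrite -lteBlDr // -EFinB; split; first by right; split=> //; exact/set_mem.
  by case=> [|[]//]; apply: le_lt_trans; rewrite lee_fin gerBl.
rewrite adde0; split; first by left.
by case=> // -[/mem_set]; rewrite (negbTE xU).
Qed.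

Lemma lscfun_le_specialization h x y : specialization_le x y -> h x <= h y.
Proof.
move=> xy; apply: lee_real_lt => r rx; apply/ltW.
exact: (xy (superlevel h r) (opens_open _) rx).
Qed.

Lemma closed_sublevel h (r : R) : closed [set x | h x <= r%:E].
Proof.
rewrite (_ : [set _ | _] = ~` superlevel h r); first exact: open_closedC (opens_open _).
by apply/seteqP; split=> x /=; rewrite leNgt => /negP.
Qed.

End lsc_operations.

Section antitone_integral.
Context {R : realType}.
Implicit Types phi : R -> \bar R.
Local Open Scope ereal_scope.
Local Notation mu := (@lebesgue_measure R).

Definition antitone phi := forall s t : R, (s <= t)%R -> phi t <= phi s.

Lemma antitone_measurable phi (D : set R) : measurable D -> antitone phi ->
  measurable_fun D phi.
Proof.
move=> mD anti; apply: (measurable_funS measurableT) => //.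
apply: (measurability _ (ErealGenOInfty.measurableE R)).
move=> /= _ [_ [a ->]] <-; apply: measurableI => //.
apply: is_interval_measurable => s t /=; rewrite !in_itv /= !andbT => _ at_ u /andP[su ut].
by rewrite in_itv /= andbT (lt_le_trans at_) // anti.
Qed.

Definition shift_left (d : R) : measurableTypeR R -> measurableTypeR R :=
  fun t => (t - d)%R.

Lemma measurable_shift_left d : measurable_fun setT (shift_left d).
Proof.
by apply: continuous_measurable_fun => x; apply: cvgB; [exact: cvg_id|exact: cvg_cst].
Qed.

Lemma lebesgue_measure_shift (d : R) (A : set R) : measurable A ->
  pushforward mu (shift_left d) A = mu A.
Proof.
move=> mA; apply/esym; apply: (lebesgue_measure_unique (mu := pushforward mu (shift_left d))) => //=.
  exact: measurable_shift_left.
move=> _ _ [[a b]] _ <-; rewrite /pushforward.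
rewrite (_ : _ @^-1` _ = [set` `](a + d)%R, (b + d)%R]]); last first.
  by apply/seteqP; split=> t; rewrite /shift_left /= !in_itv /= ltrBrDr lerBlDr.
by rewrite !lebesgue_measure_itv /= !lte_fin ltrD2r -!EFinB opprD addrACA subrr addr0.
Qed.

(** The first summand is the integral over [[-d, 0[], where [phi] is constant, which
    the translation moves into the domain. *)
Lemma integral_shift phi (d : R) : (0 <= d)%R -> antitone phi ->
  (forall t, 0 <= phi t) -> (forall t, (t < 0)%R -> phi t = phi (-1)%R) ->
  \int[mu]_(t in `[0%R, +oo[) phi (t - d)%R =
  d%:E * phi (-1)%R + \int[mu]_(t in `[0%R, +oo[) phi t.
Proof.
move=> d0 anti phi0 phineg.
have mphi (D : set R) : measurable D -> measurable_fun D phi.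
  by move=> mD; exact: antitone_measurable.
have E : `[0%R, +oo[%classic = shift_left d @^-1` `[(- d)%R, +oo[.
  by apply/seteqP; split=> t; rewrite /shift_left /= !in_itv /= !andbT lerBrDr addNr.
rewrite [LHS](_ : _ = \int[mu]_(t in shift_left d @^-1` `[(- d)%R, +oo[) (phi \o shift_left d) t);
  last by rewrite -E.
rewrite -(@ge0_integral_pushforward _ _ _ _ _ _ (measurable_shift_left d)) //; last exact: mphi.
rewrite (eq_measure_integral (@lebesgue_measure R)); last 2 first.
- exact: measurable_shift_left.
- by move=> ms A mA _; exact: lebesgue_measure_shift.
have -> : `[(- d)%R, +oo[%classic = `[(- d)%R, 0%R[ `|` `[0%R, +oo[ :> set R.
  apply/seteqP; split=> t /=; rewrite !in_itv /= !andbT.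
    by move=> dt; have [t0|t0] := ltP t 0%R; [left; rewrite dt|right].
  by case=> [/andP[]//|]; apply: le_trans; rewrite oppr_le0.
rewrite ge0_integral_setU //=; last first.
  apply/disj_setPS => t [] /=; rewrite !in_itv /= andbT => /andP[_ t0].
  by rewrite leNgt t0.
  by apply: mphi; exact: measurableU.
congr (_ + _); rewrite (eq_integral (cst (phi (-1)%R))); last first.
  by move=> t; rewrite inE /= in_itv /= => /andP[_ t0]; exact: phineg.
rewrite integral_cst //= lebesgue_measure_itv /= lte_fin oppr_lt0.
have [->|dn0] := eqVneq d 0%R; first by rewrite ltxx mule0 mul0e.
by rewrite lt0r dn0 d0 -EFinB sub0r opprK muleC.
Qed.

End antitone_integral.

Section valuation_integral.
Context {R : realType} {X : topologicalType}.
Implicit Types (f g h : lscfun R X) (U : opens X) (nu : valuation R X).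
Local Open Scope ereal_scope.
Local Notation mu := (@lebesgue_measure R).
Local Notation D := (`[0%R, +oo[%classic : set R).

Lemma valuation_superlevel_antitone nu h : antitone (fun t => nu (superlevel h t)).
Proof. by move=> s t st; apply: valuation_monotone; exact: superlevel_anti. Qed.

Lemma measurable_superlevel nu h :
  measurable_fun D (fun t => nu (superlevel h t)).
Proof. by apply: antitone_measurable => //; exact: valuation_superlevel_antitone. Qed.

Lemma val_integral_ge0 nu h : 0 <= val_integral nu h.
Proof. by apply: integral_ge0 => t _; exact: valuation_ge0. Qed.

Lemma val_integral_le nu g h : (forall x, g x <= h x) ->
  val_integral nu g <= val_integral nu h.
Proof.
move=> gh; apply: ge0_le_integral => //.
- by move=> t _; exact: valuation_ge0.
- exact: measurable_superlevel.
- exact: measurable_superlevel.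
- move=> t _; apply: valuation_monotone => x /= tg; exact: lt_le_trans (gh x).
Qed.

Lemma val_integral0 nu : val_integral nu lsc0 = 0.
Proof.
rewrite /val_integral integral0_eq // => t; rewrite /= in_itv /= andbT => t0.
rewrite -(valuation0 nu); congr (nu _); apply: opensP => x /=; split=> //.
by rewrite lte_fin ltNge t0.
Qed.

(** Modularity at each level, and translation of the levels inside of [U]. *)
Lemma val_integral_add_step nu h (d : R) (d0 : (0 <= d)%R) U :
  val_integral nu (lsc_add h (lsc_step d0 U)) = val_integral nu h + d%:E * nu U.
Proof.
pose phi t := nu (opensI U (superlevel h t)).
have phianti : antitone phi.
  move=> s t st; apply: valuation_monotone => x [Ux hx]; split => //.
  exact: superlevel_anti hx.
have phi0 t : 0 <= phi t by exact: valuation_ge0.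
have phiU t : (t < 0)%R -> phi t = nu U.
  by move=> t0; congr (nu _); rewrite superlevel_neg //; apply: opensP => x /=; tauto.
have mphi : measurable_fun D phi by exact: antitone_measurable.
have mphid : measurable_fun D (fun t => phi (t - d)%R).
  by apply: antitone_measurable => // s t st; apply: phianti; rewrite lerD2r.
have E : val_integral nu (lsc_add h (lsc_step d0 U)) + \int[mu]_(t in D) phi t =
    val_integral nu h + (d%:E * nu U + \int[mu]_(t in D) phi t).
  rewrite -(phiU (-1)%R) ?ltrN10 // -integral_shift //; last first.
    by move=> t t0; rewrite !phiU ?ltrN10.
  rewrite /val_integral -!ge0_integralD //; try exact: measurable_superlevel;
    try by move=> t _; exact: valuation_ge0.
  apply: eq_integral => t _; rewrite superlevel_step [RHS]valuation_modular.
  congr (_ + _); congr (nu _); apply: opensP => x /=.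
  split; last by case=> ? [].
  move=> [Ux hx]; split=> //; split=> //; apply: le_lt_trans hx.
  by rewrite lee_fin gerBl.
(* The common summand cancels unless it is infinite, and then so is the integral
   of [h]. *)
have [phiy|phify] := eqVneq (\int[mu]_(t in D) phi t) +oo.
  have hy : val_integral nu h = +oo.
    apply/eqP; rewrite -leye_eq -phiy; apply: ge0_le_integral => //.
      exact: measurable_superlevel.
    by move=> t _; apply: valuation_monotone => x [].
  rewrite hy addye ?gt_eqF //; last first.
    by rewrite (@lt_le_trans _ _ 0) ?ltNyr // mule_ge0 ?lee_fin ?valuation_ge0.
  apply/eqP; rewrite -leye_eq -hy; apply: val_integral_le => x /=.
  by rewrite leeDl //; case: ifP => // _; rewrite lee_fin.
have phifin : \int[mu]_(t in D) phi t \is a fin_num.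
  by rewrite ge0_fin_numE ?ltey // integral_ge0.
by rewrite -[LHS](addeK _ phifin) E addeA addeK.
Qed.

(** The value, where [g] takes the value [y], of the staircase below [g] with [m]
    steps of height [N^-1]. *)
Definition steps (N m : nat) (y : \bar R) : R :=
  \sum_(k < m) if ((k.+1%:R / N%:R)%:E < y)%E then N%:R^-1 else 0%R.

Lemma steps_term_ge0 (N k : nat) (y : \bar R) :
  (0 <= (if ((k.+1%:R / N%:R)%:E < y)%E then N%:R^-1 else 0) :> R)%R.
Proof. by case: ifP => // _; rewrite invr_ge0. Qed.

Lemma steps_ge0 N m y : (0 <= steps N m y)%R.
Proof. by apply: sumr_ge0 => k _; exact: steps_term_ge0. Qed.

Lemma steps_mono N m m' y : (m <= m')%N -> (steps N m y <= steps N m' y)%R.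
Proof.
move=> /subnK <-; elim: (m' - m)%N => // k IH; apply: (le_trans IH).
by rewrite addSn /steps big_ord_recr /= lerDl steps_term_ge0.
Qed.

Lemma steps_le N m y : (0 < N)%N -> 0 <= y -> (steps N m y)%:E <= y.
Proof.
move=> N0 y0; elim: m => [|m IH]; first by rewrite /steps big_ord0.
rewrite /steps big_ord_recr /=; case: ifPn => [my|_]; last by rewrite addr0.
apply/ltW; apply: le_lt_trans my; rewrite lee_fin -/(steps N m y).
rewrite -natr1 mulrDl div1r lerD2r; elim: (m) => [|k IHk].
  by rewrite /steps big_ord0 mul0r.
rewrite /steps big_ord_recr /= -natr1 mulrDl div1r lerD //.
by case: ifP => // _; rewrite invr_ge0.
Qed.

Lemma steps_ge N m k y : (k <= m)%N -> (k%:R / N%:R)%:E < y ->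
  (k%:R / N%:R <= steps N m y)%R.
Proof.
move=> /steps_mono km ky.
apply: le_trans (km _ _); rewrite /steps (eq_bigr (fun=> N%:R^-1)%R).
  by rewrite sumr_const card_ord mulr_natl.
move=> i _; case: ifPn => // /negP; case; apply: le_lt_trans ky.
by rewrite lee_fin ler_wpM2r ?invr_ge0 // ler_nat.
Qed.

(** Halving the height of the steps raises the staircase; hence the restriction to
    dyadic heights, for which the staircases increase. *)
Lemma steps_double N m y : (steps N m y <= steps (N * 2) (m * 2) y)%R.
Proof.
elim: m => [|m IH]; first by rewrite /steps !big_ord0.
rewrite mulSn addnC addn2 /steps 3!big_ord_recr /= -addrA lerD //.
have E : (m.+1%:R / N%:R = (m * 2).+2%:R / (N * 2)%:R :> R)%R.
  have -> : (m * 2).+2 = (m.+1 * 2)%N by rewrite mulSn.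
  by rewrite !natrM -mulf_div divff ?mulr1 ?pnatr_eq0.
rewrite -E; case: ifPn => [my|_]; last by rewrite addr_ge0 // steps_term_ge0.
rewrite ifT; last first.
  apply: le_lt_trans my; rewrite lee_fin E ler_wpM2r ?invr_ge0 // ler_nat //.
rewrite natrM invfM -mulrDr -[X in (X <= _)%R]mulr1 ler_wpM2l ?invr_ge0 //.
lra.
Qed.

Definition dyadic_steps (n : nat) := steps (2 ^ n) (4 ^ n).

Lemma dyadic_steps_mono n y : (dyadic_steps n y <= dyadic_steps n.+1 y)%R.
Proof.
apply: (le_trans (steps_double _ _ _)); rewrite /dyadic_steps !expnSr.
by apply: steps_mono; rewrite leq_mul2l orbT.
Qed.

Lemma dyadic_steps_approx (y : \bar R) (s : R) : 0 <= y -> s%:E < y ->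
  exists n, (s < dyadic_steps n y)%R.
Proof.
move=> y0 sy; have [s0|s0] := ltP s 0%R.
  by exists 0%N; apply: (lt_le_trans s0); exact: steps_ge0.
have [y' sy' y'y] := lt_real_between sy; rewrite lte_fin in sy'.
pose n := (Num.bound (y' - s)^-1 + Num.bound y')%N.
have N0 : (0 < (2 ^ n)%:R :> R)%R by rewrite ltr0n expn_gt0.
have nN : (n%:R < (2 ^ n)%:R :> R)%R by rewrite ltr_nat ltn_expl.
have y'0 : (0 < y')%R by exact: le_lt_trans sy'.
have N1 : ((y' - s)^-1 < (2 ^ n)%:R)%R.
  apply: lt_trans nN; apply: (lt_le_trans (archi_boundP _)).
    by rewrite invr_ge0 subr_ge0 ltW.
  by rewrite ler_nat leq_addr.
have N2 : (y' < (2 ^ n)%:R)%R.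
  apply: lt_trans nN; apply: (lt_le_trans (archi_boundP (ltW y'0))).
  by rewrite ler_nat leq_addl.
have sN0 : (0 <= s * (2 ^ n)%:R)%R by rewrite mulr_ge0 // ltW.
(* As [2 ^ n] exceeds [(y' - s)^-1], some [k / 2 ^ n] lies strictly between [s]
   and [y']; as it exceeds [y'], this [k] is at most [4 ^ n]. *)
have /andP[k1 k2] := Num.Theory.truncn_itv sN0.
pose k := (Num.truncn (s * (2 ^ n)%:R)).+1.
have ky : (k%:R < y' * (2 ^ n)%:R)%R.
  rewrite /k -natr1 (@le_lt_trans _ _ (s * (2 ^ n)%:R + 1)%R) ?lerD2r //.
  rewrite addrC -ltrBrDr -mulrBl mulrC -ltr_pdivrMr ?subr_gt0 //.
  by rewrite div1r.
exists n; apply: (@lt_le_trans _ _ (k%:R / (2 ^ n)%:R)%R).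
  by rewrite ltr_pdivlMr.
apply: steps_ge; last first.
  by apply: lt_trans y'y; rewrite lte_fin ltr_pdivrMr.
rewrite -(ler_nat R) (_ : 4 = 2 * 2)%N // expnMn natrM.
by rewrite (le_trans (ltW ky)) // ler_wpM2r ?(ltW N0) // ltW.
Qed.

Lemma natV_ge0 (N : nat) : (0 <= N%:R^-1 :> R)%R.
Proof. by rewrite invr_ge0. Qed.

Fixpoint staircase h g (N m : nat) : lscfun R X :=
  if m is m'.+1 then
    lsc_add (staircase h g N m') (lsc_step (natV_ge0 N) (superlevel g (m%:R / N%:R)))
  else h.

Lemma staircaseE h g N m x : staircase h g N m x = h x + (steps N m (g x))%:E.
Proof.
elim: m => [|m IH] /=; first by rewrite /steps big_ord0 adde0.
rewrite IH /steps big_ord_recr /= EFinD addeA; congr (_ + _).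
case: ifPn => [/set_mem /= ->//|]; case: ifPn => // gx.
by rewrite notin_setE /= => /(_ gx).
Qed.

Definition lower_sum nu g (n : nat) : \bar R :=
  \sum_(k < 4 ^ n) ((2 ^ n)%:R^-1)%:E * nu (superlevel g (k.+1%:R / (2 ^ n)%:R)).

Lemma val_integral_staircase nu h g n :
  val_integral nu (staircase h g (2 ^ n) (4 ^ n)) = val_integral nu h + lower_sum nu g n.
Proof.
rewrite /lower_sum; elim: (4 ^ n)%N => [|m IH]; first by rewrite big_ord0 adde0.
by rewrite /= val_integral_add_step IH big_ord_recr addeA.
Qed.

(** Monotone convergence: the superlevels of [h] plus a staircase below [g] form
    a directed family with union the superlevel of [h + g]. *)
Lemma val_integral_add_lower_sum nu h g :
  val_integral nu (lsc_add h g) =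
  ereal_sup [set val_integral nu h + lower_sum nu g n | n in [set: nat]].
Proof.
pose st n := staircase h g (2 ^ n) (4 ^ n).
have stmono n m : (n <= m)%N -> forall x, st n x <= st m x.
  move=> /subnK <-; elim: (m - n)%N => // k IH x; apply: (le_trans (IH x)).
  by rewrite /st !staircaseE leeD2l // lee_fin addSn; exact: dyadic_steps_mono.
have stle n x : st n x <= h x + g x.
  by rewrite /st staircaseE leeD2l // steps_le ?expn_gt0 ?lscfun_ge0.
have supE t : nu (superlevel (lsc_add h g) t) =
    ereal_sup (range (fun n => nu (superlevel (st n) t))).
  have -> : superlevel (lsc_add h g) t = opens_bigcup (range (fun n => superlevel (st n) t)).
    apply: opensP => x /=; split=> [|[_ [n _ <-]] /= tx]; last exact: lt_le_trans (stle n x).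
    move=> /(lt_realD_split (lscfun_ge0 _ _) (lscfun_ge0 _ _))[r [s [rh sg ->]]].
    have [n sn] := dyadic_steps_approx (lscfun_ge0 _ _) sg.
    exists (superlevel (st n) (r + s)); first by exists n.
    by rewrite /= /st staircaseE EFinD lteD // lte_fin.
  rewrite valuation_scott ?image_comp //; split; first by exists (superlevel (st 0%N) t), 0%N.
  move=> _ _ [n _ <-] [m _ <-]; exists (superlevel (st (maxn n m)) t); split.
  - by exists (maxn n m).
  - by move=> x /= tx; apply: (lt_le_trans tx); exact: stmono (leq_maxl _ _) _.
  - by move=> x /= tx; apply: (lt_le_trans tx); exact: stmono (leq_maxr _ _) _.
pose G n t := nu (superlevel (st n) t).
have Gmono t : {homo G^~ t : n m / (n <= m)%N >-> n <= m}.
  move=> n m nm; apply: valuation_monotone => x /= tx.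
  by apply: (lt_le_trans tx); exact: stmono.
have := @cvg_monotone_convergence _ _ _ mu D _ G.
move=> /(_ (measurable_itv _) (fun n => measurable_superlevel nu (st n)))
  /(_ (fun n t _ => valuation_ge0 nu _) (fun t _ => Gmono t)).
have -> : (fun t => limn (G^~ t)) = (fun t => nu (superlevel (lsc_add h g) t)).
  apply/funext => t; rewrite supE; apply/cvg_lim => //.
  exact: ereal_nondecreasing_cvgn.
rewrite -/(val_integral nu (lsc_add h g)) => cvg1.
have cvg2 : (fun n => val_integral nu (st n)) @ \oo -->
    ereal_sup (range (fun n => val_integral nu (st n))).
  by apply: ereal_nondecreasing_cvgn => n m nm; apply: val_integral_le => x; exact: stmono.
rewrite (cvg_unique _ cvg1 cvg2) //; congr ereal_sup.
by apply: eq_imagel => n _; rewrite /st val_integral_staircase.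
Qed.

Lemma val_integral_lower_sum nu g :
  val_integral nu g = ereal_sup [set lower_sum nu g n | n in [set: nat]].
Proof.
have -> : val_integral nu g = val_integral nu (lsc_add lsc0 g).
  rewrite /val_integral; apply: eq_integral => t _; congr (nu _).
  by apply: opensP => x /=; rewrite add0e.
rewrite val_integral_add_lower_sum; congr ereal_sup.
by apply: eq_imagel => n _; rewrite val_integral0 add0e.
Qed.

Lemma val_integral_subadditive nu h g :
  val_integral nu (lsc_add h g) <= val_integral nu h + val_integral nu g.
Proof.
rewrite val_integral_add_lower_sum; apply: ge_ereal_sup => _ [n _ <-].
rewrite leeD2l // val_integral_lower_sum; apply: ereal_sup_ubound.
by exists n.
Qed.

End valuation_integral.

(** * Convex combinations *)

Section convex_combinations.
Context {R : realType} {B : topConvType R}.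
Implicit Types (L : lscfun R B) (K : set B).
Local Open Scope ereal_scope.

Lemma ge0_EFinMDl (a b : R) (x : \bar R) : (0 <= a)%R -> (0 <= b)%R ->
  (a + b)%:E * x = a%:E * x + b%:E * x.
Proof. by move=> a0 b0; rewrite EFinD ge0_muleDl ?lee_fin. Qed.

(** [x +_p y] with [p = a / (a + b)], as a total function of [a] and [b]: no proof of
    [0 <= p <= 1] has to be carried along. *)
Definition mix (a b : R) (x y : B) : B :=
  if pselect (0 <= a / (a + b) /\ a / (a + b) <= 1)%R is left (conj p0 p1)
  then x <| Itv01 p0 p1 |> y else x.

Lemma affine_mix (a b : R) x y L : (0 <= a)%R -> (0 < b)%R -> affine L ->
  (a + b)%:E * L (mix a b x y) = a%:E * L x + b%:E * L y.
Proof.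
move=> a0 b0 affL; have ab0 : (0 < a + b)%R by rewrite ltr_wpDl.
rewrite /mix; case: pselect => [[p0 p1]|[]]; last first.
  by rewrite divr_ge0 ?(ltW ab0) // ler_pdivrMr // mul1r lerDl ltW.
rewrite affL /= ge0_muleDr; [|by rewrite mule_ge0 ?lscfun_ge0 ?lee_fin|
  by rewrite mule_ge0 ?lscfun_ge0 ?lee_fin // subr_ge0].
rewrite !muleA -!EFinM mulrC divfK ?gt_eqF //; congr (_ + _%:E * _).
by rewrite mulrBr mulr1 mulrC divfK ?gt_eqF // addrAC subrr add0r.
Qed.

Lemma mix_convex K a b x y : convex_subset K -> K x -> K y -> K (mix a b x y).
Proof. by move=> cK Kx Ky; rewrite /mix; case: pselect => // -[p0 p1]; exact: cK. Qed.

Lemma mix_continuous a b : topological_barycentric B ->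
  continuous (fun p : B * B => mix a b p.1 p.2).
Proof.
move=> tB p; rewrite /mix; case: pselect => [[p0 p1]|_]; last exact: cvg_fst.
pose q : unit_interval R := Itv01 p0 p1.
have pairc : (fun p : B * B => (p.1, q, p.2)) x @[x --> p] --> (p.1, q, p.2).
  have c1 : (p'.1, q) @[p' --> p] --> (p.1, q).
    by apply: (@cvg_pair _ _ _ (nbhs p) (nbhs p.1) (nbhs q)); [exact: cvg_fst|exact: cvg_cst].
  by apply: (@cvg_pair _ _ _ (nbhs p) (nbhs (p.1, q)) (nbhs p.2)); [exact: c1|exact: cvg_snd].
exact: (cvg_comp _ _ pairc (tB (p.1, q, p.2))).
Qed.

(** The points of weight [0] are unconstrained, because a transport plan assigns
    weight [0] to the points outside of the target brick. *)
Lemma convex_combination_seq (T : Type) (s : seq T) (t : T -> R) (x : T -> B) K :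
  convex_subset K -> (forall i, 0 <= t i)%R -> (forall i, 0 < t i -> K (x i))%R ->
  (0 < \sum_(i <- s) t i)%R ->
  exists2 y, K y & forall L, affine L ->
    (\sum_(i <- s) t i)%:E * L y = \sum_(i <- s) (t i)%:E * L (x i).
Proof.
move=> cK t0 Kx; elim: s => [|i s IH]; first by rewrite big_nil ltxx.
rewrite big_cons; set S := (\sum_(j <- s) t j)%R => tS.
have S0 : (0 <= S)%R by exact: sumr_ge0.
have [Sz|Snz] := eqVneq S 0%R.
  exists (x i); first by apply: Kx; move: tS; rewrite Sz addr0.
  move=> L _; rewrite Sz addr0 big_cons; apply/esym.
  rewrite [X in _ + X](_ : _ = 0) ?adde0 //.
  have : (\sum_(j <- s) t j = 0)%R by [].
  elim: (s) => [|j s' IHs]; first by rewrite !big_nil.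
  rewrite !big_cons => /eqP; rewrite paddr_eq0 ?sumr_ge0 // => /andP[/eqP -> /eqP/IHs ->].
  by rewrite mul0e add0e.
have {}S0 : (0 < S)%R by rewrite lt0r Snz.
have [y Ky yE] := IH S0.
have [ti0|ti0] := eqVneq (t i) 0%R.
  exists y => // L affL; rewrite ti0 add0r big_cons ti0 mul0e add0e -yE //.
exists (mix (t i) S (x i) y).
  by apply: mix_convex => //; apply: Kx; rewrite lt0r ti0 t0.
by move=> L affL; rewrite affine_mix // big_cons -yE.
Qed.

Lemma convex_combination (T : finType) (t : T -> R) (x : T -> B) K :
  convex_subset K -> (forall i, 0 <= t i)%R -> (forall i, 0 < t i -> K (x i))%R ->
  (0 < \sum_i t i)%R ->
  exists2 y, K y & forall L, affine L ->
    (\sum_i t i)%:E * L y = \sum_i (t i)%:E * L (x i).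
Proof. exact: convex_combination_seq. Qed.

(** The combinations of one point from each [K i] and of an arbitrary point with
    weight [r]: by induction, an image of a product of compact sets. *)
Lemma compact_combinations (T : finType) (w : T -> R) (K : T -> set B) (r : R) :
  topological_barycentric B -> compact [set: B] -> (0 < r)%R ->
  (forall i, 0 < w i)%R -> (forall i, compact (K i)) ->
  exists S : set B, [/\ compact S,
    forall y, S y -> exists (f : T -> B) (x0 : B), (forall i, K i (f i)) /\
      forall L, affine L ->
        (r + \sum_i w i)%:E * L y = r%:E * L x0 + \sum_i (w i)%:E * L (f i) &
    forall (f : T -> B) (x0 : B), (forall i, K i (f i)) ->
      exists2 y, S y & forall L, affine L ->
        (r + \sum_i w i)%:E * L y = r%:E * L x0 + \sum_i (w i)%:E * L (f i)].
Proof.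
move=> tB cB r0 w0 cK.
suff H (s : seq T) : uniq s -> exists S : set B, [/\ compact S,
    forall y, S y -> forall f, exists (g : T -> B) (x0 : B),
      (forall i, i \in s -> K i (g i)) /\ (forall i, i \notin s -> g i = f i) /\
      forall L, affine L -> (r + \sum_(i <- s) w i)%:E * L y =
        r%:E * L x0 + \sum_(i <- s) (w i)%:E * L (g i) &
    forall (f : T -> B) (x0 : B), (forall i, i \in s -> K i (f i)) ->
      exists2 y, S y & forall L, affine L -> (r + \sum_(i <- s) w i)%:E * L y =
        r%:E * L x0 + \sum_(i <- s) (w i)%:E * L (f i)].
  have [S [cS S1 S2]] := H _ (index_enum_uniq T); exists S; split => //.
    move=> y Sy; have [f [x0 [Kf [_ fE]]]] := S1 _ Sy (fun=> y).
    by exists f, x0; split => // i; apply: Kf; rewrite mem_index_enum.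
  by move=> f x0 Kf; apply: S2 => i _; exact: Kf.
elim: s => [_|i s IH /= /andP[iNs us]].
  exists setT; split => //.
    by move=> y _ f; exists f, y; split => //; split => // L _; rewrite !big_nil addr0 adde0.
  by move=> f x0 _; exists x0 => // L _; rewrite !big_nil addr0 adde0.
have [S [cS S1 S2]] := IH us.
pose b := (r + \sum_(j <- s) w j)%R.
have b0 : (0 < b)%R by rewrite ltr_wpDr // sumr_ge0 // => j _; exact: ltW.
have massE : (r + \sum_(j <- i :: s) w j = w i + b)%R by rewrite big_cons addrCA.
exists ((fun p : B * B => mix (w i) b p.1 p.2) @` (K i `*` S)); split.
- apply: continuous_compact; last exact: compact_setX.
  by apply: continuous_subspaceT; exact: mix_continuous.
- move=> _ [[z y] [/= Kz Sy] <-] f.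
  have [g [x0 [Kg [gf gE]]]] := S1 _ Sy (fun j => if j == i then z else f j).
  have gi : g i = z by rewrite gf // eqxx.
  exists g, x0; split; last split.
  + by move=> j; rewrite in_cons => /predU1P[->|/Kg//]; rewrite gi.
  + move=> j; rewrite in_cons negb_or => /andP[ji js].
    by rewrite gf // (negbTE ji).
  + move=> L affL; rewrite massE affine_mix ?(ltW (w0 _)) // gE // big_cons gi.
    by rewrite addeCA.
- move=> f x0 Kf; have [j js|y Sy yE] := S2 f x0.
    by apply: Kf; rewrite in_cons js orbT.
  exists (mix (w i) b (f i) y).
    by exists (f i, y) => //; split => //=; apply: Kf; rewrite mem_head.
  by move=> L affL; rewrite massE affine_mix ?(ltW (w0 _)) // yE // big_cons addeCA.
Qed.

End convex_combinations.

Section integral_upper_bound.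
Context {R : realType} {B : topConvType R}.
Local Open Scope ereal_scope.
Local Notation mu := (@lebesgue_measure R).

(** Layer by layer, the weights of the bricks on which [L] exceeds [t] add up
    to at most the measure of [L > t]. *)
Lemma way_below_integral (O : opens B) (xi : approximant O) (nu : valuation R B)
    (L : lscfun R B) (m : xi -> R) :
  way_below xi nu -> (forall i, 0 <= m i)%R ->
  (forall i x, (ap_open i : set B) x -> (m i)%:E <= L x) ->
  (\sum_i weight i * m i)%:E <= val_integral nu L.
Proof.
move=> xnu m0 mL.
pose A i : set R := `[0%R, m i[%classic.
have mA i : measurable (A i : set (measurableTypeR R)) by exact: measurable_itv.
pose D : set (measurableTypeR R) := `[0%R, +oo[%classic.
have mD : measurable D by exact: measurable_itv.
have mI i : measurable_fun D (fun t : measurableTypeR R => (\1_(A i) t)%:E : \bar R).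
  by apply/measurable_EFinP; exact: measurable_indic.
have mwI i : measurable_fun D (fun t : measurableTypeR R => (weight i)%:E * (\1_(A i) t)%:E).
  exact: measurable_funeM.
have w0 (i : xi) : 0 <= (weight i)%:E by rewrite lee_fin ltW // weight_gt0.
have -> : (\sum_i weight i * m i)%:E =
    \int[mu]_(t in D) \sum_(i : xi) (weight i)%:E * (\1_(A i) t)%:E.
  rewrite ge0_integral_sum //; last by move=> i t _; rewrite mule_ge0 // lee_fin.
  rewrite -sumEFin; apply: eq_bigr => i _.
  rewrite (ge0_integralZl _ mD (mI i)) //.
  rewrite integral_indic // setIidl; last first.
    by move=> t; rewrite /A /D /= !in_itv /= andbT => /andP[].
  rewrite /A /= lebesgue_measure_itv /= lte_fin EFinM; case: ltP => [mi|mi].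
    by rewrite sube0.
  by have -> : m i = 0%R by apply/le_anti; rewrite mi m0.
apply: ge0_le_integral => //.
- by move=> t _; apply: sume_ge0 => i _; rewrite mule_ge0 // lee_fin.
- exact: emeasurable_sum.
- exact: measurable_superlevel.
move=> t; rewrite /D /= in_itv /= andbT => t0.
pose I := [set i : xi | (t < m i)%R]%SET.
have -> : \sum_(i : xi) (weight i)%:E * (\1_(A i) t)%:E = (\sum_(i in I) weight i)%:E.
  rewrite -sumEFin [RHS]big_mkcond; apply: eq_bigr => i _ /=.
  rewrite inE indicE /A; case: ifPn => ti.
    by rewrite mem_set ?mule1 // /= in_itv /= t0.
  by rewrite memNset ?mule0 //= in_itv /= t0 (negbTE ti).
apply: (le_trans (way_below_le I xnu)); apply: valuation_monotone.
move=> x /opens_coverP[i]; rewrite inE => ti /mL /=; apply: lt_le_trans.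
by rewrite lte_fin.
Qed.

End integral_upper_bound.

(** * Barycenters as least points of cores *)

Section ereal_sums.
Context {R : realType}.
Local Open Scope ereal_scope.

Lemma ge0_sum_EFinM (T : Type) (s : seq T) (a : T -> R) (x : \bar R) :
  (forall i, 0 <= a i)%R ->
  \sum_(i <- s) (a i)%:E * x = (\sum_(i <- s) a i)%:E * x.
Proof.
move=> a0; elim: s => [|i s IH]; first by rewrite !big_nil mul0e.
by rewrite !big_cons IH ge0_EFinMDl // sumr_ge0.
Qed.

(** Finitely many strict inequalities leave a common margin, even if some of the
    upper bounds are infinite. *)
Lemma strict_margin (T : finType) (a : T -> R) (b : T -> \bar R) :
  (forall i, (a i)%:E < b i) -> exists e M : R, [/\ (0 < e)%R, (0 <= M)%R &
    forall i, (a i + e)%:E <= Order.min (b i) M%:E].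
Proof.
move=> ab; have /choice[r rP] : forall i, exists r : R, (a i)%:E < r%:E /\ r%:E < b i.
  by move=> i; have [r] := lt_real_between (ab i); exists r.
exists (\big[Num.min/1%R]_i (r i - a i)%R), (\big[Num.max/0%R]_i r i); split.
- apply/bigmin_gtP; split => // i _.
  by rewrite subr_gt0 -lte_fin; have [] := rP i.
- exact: bigmax_ge_id.
move=> i; have [_ rb] := rP i; apply: (@le_trans _ _ (r i)%:E).
  by rewrite lee_fin -lerBrDl; exact: bigmin_le.
by rewrite le_min ltW //= lee_fin; exact: le_bigmax.
Qed.

Lemma lt_sum_split (T : finType) (x : T -> \bar R) (r : R) :
  (forall i, 0 <= x i) -> r%:E < \sum_i x i ->
  exists2 a : T -> R, forall i, (a i)%:E < x i & (r <= \sum_i a i)%R.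
Proof.
move=> x0; have := index_enum_uniq T; elim: (index_enum T) r => [|i s IH] r /=.
  rewrite big_nil lte_fin => _ r0; exists (fun=> (-1)%R).
    by move=> i; rewrite (lt_le_trans _ (x0 i)) // lte_fin ltrN10.
  by rewrite big_nil ltW.
move=> /andP[iNs us]; rewrite big_cons => /(lt_realD_split (x0 i)).
rewrite sume_ge0 // => /(_ isT)[p [q [pi /IH[]// a ax qa ->]]].
exists (fun j => if j == i then p else a j).
  by move=> j; case: eqP => [->|].
rewrite big_cons eqxx lerD2l; apply: (le_trans qa); rewrite !big_seq.
rewrite le_eqVlt; apply/orP; left; apply/eqP; apply: eq_bigr => j js.
by case: eqP js iNs => // -> ->.
Qed.

End ereal_sums.

Section barycenters.
Context {R : realType} {B : topConvType R}.
Local Open Scope ereal_scope.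
Notation approx := (approximant (@opensT B)).
Implicit Types (L : lscfun R B) (nu : valuation R B) (xi zeta : approx).

(** The accuracy reached in [approx_family], which can be refined to meet several
    demands with one approximant. *)
Definition resolves (S : finType) (E : S -> opens B) (e M : R) nu zeta :=
  Order.min (nu opensT) M%:E <= (mass zeta + e)%:E /\
  forall J : {set S},
    Order.min (nu (opens_cover E J)) M%:E <= (captured E zeta J + e)%:E.

Lemma resolves_le (S : finType) (E : S -> opens B) (e e' M M' : R) nu zeta :
  (e <= e')%R -> (M' <= M)%R -> resolves E e M nu zeta -> resolves E e' M' nu zeta.
Proof.
move=> ee MM [mz cz]; split.
  apply: (le_trans (le_trans _ mz)); last by rewrite lee_fin lerD2l.
  by rewrite le_min !ge_min lexx /= lee_fin MM orbT.
move=> J; apply: (le_trans (le_trans _ (cz J))); last by rewrite lee_fin lerD2l.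
by rewrite le_min !ge_min lexx /= lee_fin MM orbT.
Qed.

(** [P] is the class of test functions.  A family of bricks of total mass [m] is
    completed by a free point of [B] with weight [rho m]: in a barycentric algebra
    this brings the total to [1], in a cone the weight is the constant [1] and the
    free point may be [0].  [light] singles out the masses that occur, and
    [scaling] multiplies by the total [rho m + m], which is needed in cones
    because combinations are formed with total weight [1]. *)
Variables (P : lscfun R B -> Prop) (rho : R -> R) (light : R -> Prop).
Hypothesis P_affine : forall L, P L -> affine L.
Hypothesis P0 : P lsc0.
Hypothesis PD : forall L L', P L -> P L' -> P (lsc_add L L').
Hypothesis P_sep : forall x y : B, ~ specialization_le x y ->
  exists2 L, P L & L y < L x.
Hypothesis rho_gt0 : forall m, light m -> (0 < rho m)%R.
Hypothesis rho_mono : forall m m', light m -> light m' -> (m <= m')%R ->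
  (rho m <= rho m' + (m' - m))%R.
Hypothesis scaling : forall m, light m -> exists2 s : B -> B, continuous s &
  forall y L, P L -> L (s y) = (rho m + m)%:E * L y.
Hypothesis cB : compact [set: B].
Hypothesis tB : topological_barycentric B.
Hypothesis lcc : @locally_convex_compact R B.
Hypothesis sobB : sober B.

Definition combination_value xi (f : xi -> B) (x0 : B) L :=
  (rho (mass xi))%:E * L x0 + \sum_(i : xi) (weight i)%:E * L (f i).

(** The upward closure of the weighted sum of the bricks.  The order is expressed
    by the test functions, which determine it. *)
Definition region xi : set B := [set x | exists (f : xi -> B) (x0 : B),
  (forall i, ap_set i (f i)) /\
  forall L, P L -> combination_value f x0 L <= L x].

Lemma region_saturated xi : saturated (region xi).
Proof.
move=> x y xy [f [x0 [Kf fx]]]; exists f, x0; split => // L /fx.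
by move=> /le_trans; apply; exact: lscfun_le_specialization.
Qed.

Lemma region_combination xi (f : xi -> B) (x0 : B) : light (mass xi) ->
  (forall i, ap_set i (f i)) ->
  exists2 x, region xi x & forall L, P L -> L x = combination_value f x0 L.
Proof.
move=> lxi Kf.
have [S [_ _ /(_ f x0 Kf)[y Sy yE]]] := @compact_combinations _ _ _ _
  (@ap_set _ _ _ xi) _ tB cB (rho_gt0 lxi) (@weight_gt0 _ _ _ xi)
  (fun i => @brick_compact _ _ _ (ap_brick i)).
have [s _ sE] := scaling lxi.
have xE L : P L -> L (s y) = combination_value f x0 L.
  by move=> PL; rewrite sE // yE //; exact: P_affine.
by exists (s y) => //; exists f, x0; split => // L /xE ->.
Qed.

Lemma region_compact xi : light (mass xi) -> compact (region xi).
Proof.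
move=> lxi; have [S [cS S1 S2]] := @compact_combinations _ _ _ _
  (@ap_set _ _ _ xi) _ tB cB (rho_gt0 lxi) (@weight_gt0 _ _ _ xi)
  (fun i => @brick_compact _ _ _ (ap_brick i)).
have [s cs sE] := scaling lxi.
apply: (@compact_upward _ (s @` S)).
- by apply: continuous_compact => //; exact: continuous_subspaceT.
- move=> _ [y Sy <-]; have [f [x0 [Kf yE]]] := S1 _ Sy.
  exists f, x0; split => // L PL; rewrite sE // yE //; exact: P_affine.
move=> x [f [x0 [Kf fx]]]; have [y Sy yE] := S2 f x0 Kf.
exists (s y); first by exists y.
apply: contrapT => /P_sep[L PL]; rewrite sE // yE; last exact: P_affine.
by rewrite ltNge fx.
Qed.

(** The transport lemma cuts the bricks of [zeta] into pieces lying in the bricks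
    of [xi]; by convexity the pieces used for one brick combine to a point in
    it, and what is left over combines to a point of [B]. *)
Lemma region_refine xi nu : way_below xi nu -> light (mass xi) ->
  exists e M : R, [/\ (0 < e)%R, (0 <= M)%R &
    forall (S : finType) (E : S -> opens B) (emb : xi -> S) zeta,
      (forall i, E (emb i) = ap_open i) -> light (mass zeta) ->
      resolves E e M nu zeta -> region zeta `<=` region xi].
Proof.
move=> xnu lxi.
(* For the empty family, whose condition is not strict, [-1] is a placeholder. *)
pose a (I : {set xi}) : R := if I == finset.set0 then (-1)%R else (\sum_(i in I) weight i)%R.
have [|e [M [e0 M0 aM]]] := @strict_margin _ _ a (fun I => nu (opens_cover (@ap_open _ _ _ xi) I)).
  move=> I; rewrite /a; case: ifPn => [_|/xnu//].
  by rewrite (lt_le_trans _ (valuation_ge0 _ _)) // lte_fin ltrN10.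
exists e, M; split => // S E emb zeta Eemb lzeta [_ cz].
pose edge (i : xi) (k : zeta) := `[< ap_set k `<=` ap_open i >].
have w0 (Z : approx) (k : Z) : (0 <= weight k)%R by exact/ltW/weight_gt0.
have hall (I : {set xi}) :
    (\sum_(i in I) weight i <= \sum_(k in neighbours edge I) weight k)%R.
  have [->|In0] := eqVneq I finset.set0; first by rewrite big_set0 sumr_ge0.
  have := le_trans (aM I) (_ : _ <= (captured E zeta (emb @: I)%SET + e)%:E).
  rewrite /a (negbTE In0) lee_fin lerD2r => h; apply: (le_trans (h _)).
    rewrite (_ : opens_cover _ I = opens_cover E (emb @: I)%SET) ?cz //.
    apply: opensP => x; split=> /opens_coverP[i iI ix]; apply/opens_coverP.
      by exists (emb i); [exact: imset_f|rewrite Eemb].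
    by have /imsetP[j jI ij] := iI; exists j => //; rewrite -Eemb -ij.
  rewrite le_eqVlt; apply/orP; left; apply/eqP; apply: eq_bigl => k.
  rewrite !inE; apply/exists_inP/exists_inP => -[i iI ik].
    by have /imsetP[j jI ij] := iI; exists j => //; rewrite /edge -Eemb -ij.
  by exists (emb i); [exact: imset_f|rewrite Eemb].
have [t [t0 te ta tc]] := transport (w0 xi) (w0 zeta) hall.
pose l k := (weight k - \sum_i t i k)%R.
have l0 k : (0 <= l k)%R by rewrite subr_ge0.
have suml : (\sum_k l k = mass zeta - mass xi)%R.
  rewrite sumrB exchange_big /=; congr (_ - _)%R.
  by apply: eq_bigr => i _; rewrite ta.
have mxz : (mass xi <= mass zeta)%R by rewrite -subr_ge0 -suml sumr_ge0.
move=> x [f [x0 [Kf fx]]].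
have /choice[y yP] (i : xi) : exists y, ap_set i y /\ forall L, affine L ->
    (weight i)%:E * L y = \sum_k (t i k)%:E * L (f k).
  have [||||y Ky yE] := @convex_combination _ _ _ (t i) f (ap_set i).
  - exact: brick_convex.
  - exact: t0.
  - move=> k tik; have : edge i k.
      by apply/negPn/negP => /te tik0; rewrite tik0 ltxx in tik.
    by move=> /asboolP/(_ _ (Kf k))/brick_open_sub.
  - by rewrite ta weight_gt0.
  by exists y; split => // L /yE; rewrite ta.
pose tau := (rho (mass zeta) + \sum_k l k)%R.
have rz0 := rho_gt0 lzeta.
have tau0 : (0 < tau)%R by rewrite ltr_wpDr // sumr_ge0.
have [y0 y0E] : exists y0, forall L, affine L ->
    tau%:E * L y0 = (rho (mass zeta))%:E * L x0 + \sum_k (l k)%:E * L (f k).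
  have := @convex_combination_seq _ _ (option zeta)
    (None :: [seq Some k | k <- index_enum zeta]) (oapp l (rho (mass zeta)))
    (oapp f x0) setT.
  case=> //.
  - by case=> //=; exact: ltW.
  - by rewrite big_cons big_map.
  move=> y0 _ y0E; exists y0 => L /y0E; rewrite !big_cons !big_map /=; exact.
exists y, y0; split; first by move=> i; have [] := yP i.
move=> L PL; apply: le_trans (fx L PL); rewrite /combination_value.
have affL := P_affine PL.
apply: (@le_trans _ _ (tau%:E * L y0 + \sum_i (weight i)%:E * L (y i))).
  rewrite leeD2r // lee_wpmul2r ?lscfun_ge0 // lee_fin /tau suml.
  exact: rho_mono.
rewrite y0E // -addeA leeD2l //.
rewrite (eq_bigr (fun i => \sum_k (t i k)%:E * L (f k))); last first.
  by move=> i _; have [_ ->] := yP i.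
rewrite exchange_big /= -big_split /=; apply: lee_sum => k _.
rewrite ge0_sum_EFinM // -ge0_EFinMDl // ?sumr_ge0 // /l subrK //.
Qed.

(** The second condition provides free points whose contribution to a given
    integrable test function vanishes as the approximants exhaust [nu]. *)
Definition admissible nu :=
  (forall xi, way_below xi nu -> light (mass xi)) /\
  forall L, P L -> val_integral nu L < +oo -> forall e : R, (0 < e)%R ->
    exists (x0 : B) (d M : R), [/\ (0 < d)%R, (0 <= M)%R & forall m, light m ->
      Order.min (nu opensT) M%:E <= (m + d)%:E -> (rho m)%:E * L x0 <= e%:E].

Definition regions nu : set (set B) :=
  [set K | exists2 xi, way_below xi nu & K = region xi].

Definition core nu : set B := \bigcap_(K in regions nu) K.

Lemma coreP nu x : core nu x <-> forall xi, way_below xi nu -> region xi x.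
Proof.
split=> [cx xi xnu|cx _ [xi xnu ->]]; last exact: cx.
by apply: cx; exists xi.
Qed.

(** Approximate [nu] on the superlevels of [L] that occur in a lower sum. *)
Lemma core_ge nu L x : admissible nu -> P L -> core nu x -> val_integral nu L <= L x.
Proof.
move=> [lnu _] PL /coreP cx; apply: lee_real_lt => r.
rewrite val_integral_lower_sum => /ereal_sup_gt[_ [n _ <-]].
have N0 : (0 < (2 ^ n)%:R :> R)%R by rewrite ltr0n expn_gt0.
set N := (2 ^ n)%N in N0 *; set m := (4 ^ n)%N.
pose E (k : 'I_m) := superlevel L (k.+1%:R / N%:R).
rewrite /lower_sum -/N -/m => /lt_sum_split[k|a aE ra].
  by rewrite mule_ge0 ?valuation_ge0 // lee_fin invr_ge0 ltW.
have [k|e [M [e0 M0 aM]]] := @strict_margin _ _ (fun k => N%:R * a k)%R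
    (fun k : 'I_m => nu (opens_cover E [set k]%SET)).
  rewrite EFinM -lte_pdivlMl // (lt_le_trans (aE k)) //.
  rewrite lee_wpmul2l // ?lee_fin ?invr_ge0 ?(ltW N0) //.
  apply: valuation_monotone => y Ey; apply/opens_coverP; exists k => //.
  by rewrite finset.in_set1.
have [zeta [znu _ cz]] := approx_family lcc E nu e0 M0.
have [f [x0 [Kf fx]]] := cx _ znu.
apply: le_trans (fx L PL); rewrite /combination_value.
have lz : 0 <= (rho (mass zeta))%:E * L x0.
  by rewrite mule_ge0 ?lscfun_ge0 // lee_fin ltW //; exact/rho_gt0/lnu.
rewrite (le_trans _ (leeDr _ lz)) //.
apply: (@le_trans _ _ (\sum_(j : zeta) weight j * steps N m (L (f j)))%:E); last first.
  rewrite -sumEFin; apply: lee_sum => j _; rewrite EFinM lee_wpmul2l //.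
    by rewrite lee_fin ltW // weight_gt0.
  by rewrite steps_le ?lscfun_ge0 // -(ltr0n R).
rewrite lee_fin; apply: (le_trans ra).
under [leRHS]eq_bigr do rewrite /steps mulr_sumr.
rewrite exchange_big /=; apply: ler_sum => k _.
apply: (@le_trans _ _ (N%:R^-1 * captured E zeta [set k]%SET)%R).
  by rewrite ler_pdivlMl // -(lerD2r e) -lee_fin (le_trans (aM k)).
rewrite mulr_sumr big_mkcond; apply: ler_sum => j _.
have t0 : (0 <= weight j * (if ((k.+1%:R / N%:R)%:E < L (f j))%E then N%:R^-1 else 0))%R.
  by rewrite mulr_ge0 ?steps_term_ge0 // ltW // weight_gt0.
case: ifPn => //; rewrite inE => /exists_inP[k']; rewrite finset.in_set1 => /eqP ->.
by move=> /asboolP/(_ _ (Kf j)) /= ->; rewrite mulrC.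
Qed.

(** One approximant that resolves the bricks of two others refines both. *)
Lemma regions_filtered nu : admissible nu -> filtered (regions nu).
Proof.
move=> [lnu _]; split.
  by exists (region (ap_void _)), (ap_void _) => //; exact: way_below_void.
move=> _ _ [xi1 xnu1 ->] [xi2 xnu2 ->].
have [e1 [M1 [e10 M10 H1]]] := region_refine xnu1 (lnu _ xnu1).
have [e2 [M2 [e20 M20 H2]]] := region_refine xnu2 (lnu _ xnu2).
pose E (i : xi1 + xi2) := match i with inl i => ap_open i | inr i => ap_open i end.
have e0 : (0 < Num.min e1 e2)%R by rewrite lt_min e10.
have M0 : (0 <= Num.max M1 M2)%R by rewrite le_max M10.
have [zeta [znu mz cz]] := approx_family lcc E nu e0 M0.
have rz : resolves E (Num.min e1 e2) (Num.max M1 M2) nu zeta by [].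
exists (region zeta); first by exists zeta.
rewrite subsetI; split.
  apply: (H1 _ E inl) => //; first exact: lnu.
  by apply: resolves_le rz; rewrite ?ge_min ?le_max lexx.
apply: (H2 _ E inr) => //; first exact: lnu.
by apply: resolves_le rz; rewrite ?ge_min ?le_max lexx ?orbT.
Qed.

(** In a fine approximation of [nu] choose in each brick a point where [L] is
    almost minimal. *)
Lemma sublevel_meets_region nu L xi (e : R) : admissible nu -> P L ->
  val_integral nu L < +oo -> (0 < e)%R -> way_below xi nu ->
  exists2 x, region xi x & L x <= val_integral nu L + e%:E.
Proof.
move=> [lnu fill] PL Lfin e0 xnu.
have e20 : (0 < e / 2)%R by rewrite divr_gt0.
have [e1 [M1 [e10 M10 H1]]] := region_refine xnu (lnu _ xnu).
have [x0 [d [M [d0 M0 x0P]]]] := fill _ PL Lfin _ e20.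
have e'0 : (0 < Num.min e1 d)%R by rewrite lt_min e10.
have M'0 : (0 <= Num.max M1 M)%R by rewrite le_max M10.
have [zeta [znu mz cz]] := approx_family lcc (@ap_open _ _ _ xi) nu e'0 M'0.
have rz : resolves (@ap_open _ _ _ xi) (Num.min e1 d) (Num.max M1 M) nu zeta by [].
have [||mzd _] := @resolves_le _ _ _ d _ M _ _ _ _ rz.
- by rewrite ge_min lexx orbT.
- by rewrite le_max lexx orbT.
have mass0 := mass_ge0 zeta.
have w0 (k : zeta) : (0 < weight k)%R by exact: weight_gt0.
have ne (k : zeta) : (ap_open k : set B) !=set0.
  apply: contrapT => nk.
  have kn0 : [set k]%SET != finset.set0.
    by apply/finset.set0Pn; exists k; rewrite finset.in_set1.
  have := znu _ kn0.
  rewrite big_set1 (_ : opens_cover _ _ = opens0) ?valuation0; last first.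
    apply: opensP => y; split=> // /opens_coverP[k']; rewrite finset.in_set1.
    by move=> /eqP -> ky; case: nk; exists y.
  by rewrite lte_fin ltNge ltW.
pose I (k : zeta) := ereal_inf [set L x | x in (ap_open k : set B)].
have I0 k : 0 <= I k by apply: le_ereal_inf_tmp => _ [x _ <-]; exact: lscfun_ge0.
have IL k x : (ap_open k : set B) x -> I k <= L x.
  by move=> kx; apply: ereal_inf_lbound; exists x.
have Ifin k : I k \is a fin_num.
  rewrite ge0_fin_numE // ltey; apply/eqP => Iy.
  pose c := fine (val_integral nu L).
  have cE : val_integral nu L = c%:E by rewrite fineK // ge0_fin_numE ?val_integral_ge0.
  have c0 : (0 <= c)%R by rewrite -lee_fin -cE val_integral_ge0.
  (* The single brick [k] would contribute more than [c]. *)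
  have := @way_below_integral _ _ _ zeta nu L
    (fun j => if j == k then ((c + 1) / weight k)%R else 0%R) znu.
  rewrite cE (bigD1 k) //= eqxx big1 => [|j /negbTE ->]; last by rewrite mulr0.
  rewrite addr0 (_ : weight k * _ = c + 1)%R; last by rewrite mulrC divfK ?gt_eqF.
  rewrite lee_fin gerDl ler10 => H; suff: false by [].
  apply: H => [j|j x jx].
    by case: ifP => // _; rewrite divr_ge0 ?addr_ge0 // ltW.
  case: eqP => [jk|_]; last exact: lscfun_ge0.
  by rewrite jk in jx; rewrite (le_trans _ (IL _ _ jx)) // Iy leey.
(* The error [e / 2] distributed over the total weight of the bricks. *)
pose dl := (e / 2 / (mass zeta + 1))%R.
have m1 : (0 < mass zeta + 1)%R by rewrite ltr_wpDl.
have dl0 : (0 < dl)%R by rewrite divr_gt0.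
have /choice[f fP] (k : zeta) : exists x, (ap_open k : set B) x /\ L x <= I k + dl%:E.
  have [_ [x kx <-] /ltW Lx] := lb_ereal_inf_adherent dl0 (Ifin k).
  by exists x.
have [|x rx xE] := @region_combination zeta f x0 (lnu _ znu).
  by move=> k; apply: brick_open_sub; have [] := fP k.
exists x; first by apply: (H1 _ (@ap_open _ _ _ xi) id) rx => //; [exact: lnu|
  apply: resolves_le rz; rewrite ?ge_min ?le_max lexx].
rewrite xE // /combination_value addeC [e]splitr EFinD addeA leeD ?x0P //; last exact: lnu.
apply: (@le_trans _ _ (\sum_(k : zeta) weight k * fine (I k) + mass zeta * dl)%:E).
  rewrite EFinD /mass mulr_suml -!sumEFin -big_split /=; apply: lee_sum => k _.
  rewrite -EFinD -mulrDr EFinM lee_wpmul2l ?lee_fin ?(ltW (w0 k)) //.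
  by have [_] := fP k; rewrite EFinD fineK.
rewrite EFinD leeD //.
  apply: way_below_integral => // [k|k y ky]; first by rewrite fine_ge0.
  by rewrite fineK // IL.
rewrite lee_fin /dl mulrCA ler_piMr ?(ltW e20) // ler_pdivrMr // mul1r lerDl //.
Qed.

Lemma core_sublevel nu L (e : R) : admissible nu -> P L ->
  val_integral nu L < +oo -> (0 < e)%R ->
  exists2 x, core nu x & L x <= val_integral nu L + e%:E.
Proof.
move=> anu PL Lfin e0.
have cE : val_integral nu L = (fine (val_integral nu L))%:E.
  by rewrite fineK // ge0_fin_numE ?val_integral_ge0.
have [||||x [Lx cx]] := @sober_well_filtered _ (regions nu)
  [set x | L x <= (fine (val_integral nu L) + e)%:E] sobB (regions_filtered anu).
- by move=> _ [xi xnu ->]; apply: region_compact; exact: anu.1.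
- by move=> _ [xi xnu ->]; exact: region_saturated.
- exact: closed_sublevel.
- move=> _ [xi xnu ->]; have [x rx Lx] := sublevel_meets_region anu PL Lfin e0 xnu.
  by exists x; split => //=; rewrite EFinD -cE.
by exists x => //; rewrite cE.
Qed.

(** On the core every [L] is at least its integral, so that a point where a sum
    is almost minimal is one where both summands are: the sublevels of [L] over
    the core have the finite intersection property. *)
Lemma core_represents nu : admissible nu ->
  exists2 x, core nu x & represents P nu x.
Proof.
move=> anu.
pose F : set (set B) := [set A | exists L (e : R), [/\ P L, val_integral nu L < +oo,
  (0 < e)%R & A = [set x | L x <= (fine (val_integral nu L) + e)%:E]]].
have fE L : val_integral nu L < +oo -> val_integral nu L = (fine (val_integral nu L))%:E.
  by move=> Lfin; rewrite fineK // ge0_fin_numE ?val_integral_ge0.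
have ccore : compact (core nu).
  apply: compact_bigcap_filtered => //; first exact: regions_filtered.
  - by move=> _ [xi xnu ->]; apply: region_compact; exact: anu.1.
  - by move=> _ [xi xnu ->]; exact: region_saturated.
have [||||x [cx Fx]] := @compact_filtered_closed _ _ F ccore.
- exists [set x | lsc0 x <= (fine (val_integral nu lsc0) + 1)%:E], lsc0, 1%R.
  by split => //; rewrite val_integral0 ltry.
- move=> _ _ [L [e [PL Lfin e0 ->]]] [L' [e' [PL' Lfin' e'0 ->]]].
  pose d := Num.min e e'.
  have LL'fin : val_integral nu (lsc_add L L') < +oo.
    by rewrite (le_lt_trans (val_integral_subadditive _ _ _)) // lte_add_pinfty.
  exists [set x | lsc_add L L' x <= (fine (val_integral nu (lsc_add L L')) + d)%:E].
    exists (lsc_add L L'), d; split => //; first exact: PD.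
    by rewrite lt_min e0.
  move=> x [cx] /=; rewrite EFinD -fE // => xLL'.
  have {}xLL' : L x + L' x <= val_integral nu L + val_integral nu L' + d%:E.
    by rewrite (le_trans xLL') // leeD2r // val_integral_subadditive.
  have Lx := core_ge anu PL cx; have L'x := core_ge anu PL' cx.
  move: (fine (val_integral nu L)) (fE _ Lfin) => c cE.
  move: (fine (val_integral nu L')) (fE _ Lfin') => c' c'E.
  rewrite cE c'E -!EFinD in xLL' Lx L'x *; split.
    apply: (@le_trans _ _ ((c + c' + d)%:E - c'%:E)).
      by rewrite leeBrDr // (le_trans _ xLL') // leeD2l.
    have : (d <= e)%R by rewrite ge_min lexx.
    by rewrite -EFinB lee_fin -lerBlDl; apply: le_trans; lra.
  apply: (@le_trans _ _ ((c + c' + d)%:E - c%:E)).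
    by rewrite leeBrDl // (le_trans _ xLL') // leeD2r.
  have : (d <= e')%R by rewrite ge_min lexx orbT.
  by rewrite -EFinB lee_fin -lerBlDl; apply: le_trans; lra.
- by move=> _ [L [e [_ _ _ ->]]]; exact: closed_sublevel.
- move=> _ [L [e [PL Lfin e0 ->]]]; have [x cx Lx] := core_sublevel anu PL Lfin e0.
  by exists x; split => //=; rewrite EFinD -fE.
exists x => // L PL; apply/eqP; rewrite eq_le core_ge // andbT.
have [Ly|Lfin] := eqVneq (val_integral nu L) +oo; first by rewrite Ly leey.
rewrite fE; last by rewrite ltey.
apply/lee_addgt0Pr => e e0.
have := Fx [set x | L x <= (fine (val_integral nu L) + e)%:E]; rewrite /= EFinD.
by apply; exists L, e; split => //; rewrite ltey.
Qed.

Lemma represents_unique nu x y : represents P nu x -> represents P nu y -> x = y.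
Proof.
move=> rx ry; have le z t : represents P nu z -> represents P nu t -> specialization_le z t.
  move=> rz rt; apply: contrapT => /P_sep[L PL].
  by rewrite rz // rt // ltxx.
by apply: specialization_le_anti; [case: sobB|exact: le|exact: le].
Qed.

Lemma core_above nu x y : admissible nu -> represents P nu x -> core nu y ->
  specialization_le x y.
Proof.
move=> anu rx cy; apply: contrapT => /P_sep[L PL].
by rewrite rx // ltNge core_ge.
Qed.

Lemma way_below_near xi nu : way_below xi nu ->
  nbhs nu [set nu' : valuation R B | way_below xi nu'].
Proof.
move=> xnu.
have H (I : {set xi}) : nbhs nu [set nu' : valuation R B | I != finset.set0 ->
    (\sum_(i in I) weight i)%:E < nu' (opens_cover (@ap_open _ _ _ xi) I)].
  have [->|In0] := eqVneq I finset.set0; first by apply: filterE.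
  pose W := [set nu' : valuation R B |
    (\sum_(i in I) weight i)%:E < nu' (opens_cover (@ap_open _ _ _ xi) I)].
  have oW : open W.
    exists [set W]; last by rewrite bigcup_set1.
    move=> _ ->; apply: (@finI_from1 _ _ _ id); exists (opens_cover (@ap_open _ _ _ xi) I).
    exists (\sum_(i in I) weight i)%R; split => //.
    have /finset.set0Pn[i iI] := In0; rewrite (bigD1 i) //= ltr_wpDr ?weight_gt0 //.
    by apply: sumr_ge0 => j _; exact/ltW/weight_gt0.
  have := open_nbhs_nbhs (conj oW (xnu I In0)).
  by apply: filterS => nu' + _.
have HI := @filter_forall _ _ _ (nbhs nu) (nbhs_filter nu) H.
by apply: filterS HI => nu' h I; exact: h.
Qed.

(** The core of [nu] lies in [U], hence so does one of the regions, and that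
    region contains the barycenters of all valuations near [nu]. *)
Lemma represents_continuous nu x (U : opens B) : admissible nu ->
  represents P nu x -> (U : set B) x ->
  nbhs nu [set nu' | admissible nu' ->
    forall x', represents P nu' x' -> (U : set B) x'].
Proof.
move=> anu rx Ux.
have [xi xnu xiU] : exists2 xi, way_below xi nu & region xi `<=` U.
  apply: contrapT => nxi.
  have [||||y [nUy cy]] := @sober_well_filtered _ (regions nu) (~` U) sobB (regions_filtered anu).
  - by move=> _ [xi xnu ->]; apply: region_compact; exact: anu.1.
  - by move=> _ [xi xnu ->]; exact: region_saturated.
  - exact: open_closedC (opens_open U).
  - move=> _ [xi xnu ->]; apply: contrapT => ne; apply: nxi; exists xi => //.
    by move=> z rz; apply: contrapT => nUz; apply: ne; exists z.
  by apply: nUy; apply: (core_above anu rx cy) Ux; exact: opens_open.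
have := way_below_near xnu; apply: filterS => nu' xnu' anu' x' rx'.
have [y cy ry] := core_represents anu'.
by rewrite (represents_unique rx' ry); apply: xiU; move/coreP: cy; apply.
Qed.

Lemma represents_map (V : topologicalType) (i : V -> valuation R B) :
  continuous i -> (forall v, admissible (i v)) ->
  continuous_barycenter_map (fun v x => represents P (i v) x).
Proof.
move=> ci ai; have /choice[beta betaP] v : exists x, represents P (i v) x.
  by have [x _ rx] := core_represents (ai v); exists x.
exists beta; split=> [v|v W].
  by split => // x; exact: represents_unique.
rewrite nbhsE => -[U [oU Uv] UW].
have near_nu := @represents_continuous _ _ (Opens oU) (ai v) (betaP v) Uv.
have near_v := ci v _ near_nu; apply: (@filterS _ (nbhs v)) near_v => v' /= h.
exact/UW/(h (ai v') _ (betaP v')).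
Qed.

End barycenters.

(** * The three cases *)

Section affine_functions.
Context {R : realType} {B : topConvType R}.
Implicit Types (L : lscfun R B) (nu : valuation R B).
Local Open Scope ereal_scope.

Lemma affine0 : affine (@lsc0 R B).
Proof. by move=> a x y /=; rewrite !mule0 adde0. Qed.

Lemma affine_add L L' : affine L -> affine L' -> affine (lsc_add L L').
Proof.
move=> aL aL' a x y /=; rewrite aL aL' !ge0_muleDr ?lscfun_ge0 //.
by rewrite addeACA.
Qed.

Lemma mass_lt1 (xi : approximant (@opensT B)) nu : nu opensT <= 1 ->
  way_below xi nu -> (mass xi < 1)%R.
Proof.
move=> nu1 xnu; case: (pickP (fun _ : xi => true)) => [i _|noi].
  rewrite -lte_fin; apply: lt_le_trans nu1.
  have -> : mass xi = (\sum_(j in [set: xi]%SET) weight j)%R.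
    by apply: eq_bigl => j; rewrite finset.in_setT.
  have xi0 : [set: xi]%SET != finset.set0.
    by apply/finset.set0Pn; exists i; rewrite finset.in_setT.
  by apply: (lt_le_trans (xnu _ xi0)); exact: valuation_monotone.
by rewrite /mass big_pred0 ?ltr01.
Qed.

Lemma val_integral_lty_fin nu L : 0 < nu opensT -> val_integral nu L < +oo ->
  exists x, L x < +oo.
Proof.
move=> nu0 Lfin; apply: contrapT => noL; move: Lfin; apply/negP; rewrite -leNgt.
rewrite /val_integral (eq_integral (cst (nu opensT))); last first.
  move=> t _; congr (nu _); apply: opensP => x /=; split => // _.
  have : ~ L x < +oo by move=> Lx; apply: noL; exists x.
  by move=> /negP; rewrite -leNgt leye_eq => /eqP ->; rewrite ltry.
by rewrite integral_cst //= lebesgue_measure_itv /= ltry gt0_muley.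
Qed.

Lemma affine_shift L L' (l : R) : (0 <= l)%R -> affine L ->
  (forall x, L x = L' x + l%:E) -> affine L'.
Proof.
move=> l0 aL LE a x y; have lfin : l%:E \is a fin_num by [].
rewrite -[LHS](addeK _ lfin) -LE aL !LE.
rewrite !ge0_muleDr ?lscfun_ge0 ?lee_fin // addeACA -!EFinM -EFinD -mulrDl.
by rewrite (addrC a%:num%R) subrK mul1r addeK.
Qed.

(** Test functions are monotone, so that the value at [bot] is the least one and
    its subtraction turns an affine function into a pointed linear one. *)
Definition lsc_sub_bot (bot : B) (lb : least bot) L (Lbot : L bot \is a fin_num) :
  lscfun R B.
Proof.
apply: (@LscFun _ _ (fun x => L x - L bot)) => [x|x a].
  by rewrite sube_ge0 ?Lbot // lscfun_le_specialization.
rewrite lteBrDr // -(fineK Lbot) -EFinD => /lscfun_lsc[V xV VL].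
by exists V => // y /VL; rewrite EFinD fineK // lteBrDr.
Defined.

Lemma pointed_linear_sub_bot (bot : B) (lb : least bot) L
    (Lbot : L bot \is a fin_num) :
  affine L -> pointed_linear bot (lsc_sub_bot lb Lbot).
Proof.
move=> aL; set L' := lsc_sub_bot lb Lbot.
have L'E x : L x = L' x + (fine (L bot))%:E by rewrite /= fineK // subeK.
have aL' : affine L'.
  by apply: affine_shift aL L'E; rewrite fine_ge0 // lscfun_ge0.
split => // a x; rewrite aL' [X in _ + _ * X](_ : _ = 0) ?mule0 ?adde0 //=.
by rewrite subee.
Qed.

Lemma pointed_linear_separated (bot x y : B) : @linearly_separated R B ->
  least bot -> ~ specialization_le x y ->
  exists2 L, pointed_linear bot L & L y < L x.
Proof.
move=> sep lb /sep[L aL Lyx].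
have Lbot : L bot \is a fin_num.
  rewrite ge0_fin_numE ?lscfun_ge0 //; apply: (@le_lt_trans _ _ (L y)).
    by apply: lscfun_le_specialization; exact: lb.
  by apply: (lt_le_trans Lyx); rewrite leey.
exists (lsc_sub_bot lb Lbot); first exact: pointed_linear_sub_bot.
by rewrite /= lte_leB.
Qed.

End affine_functions.

Section probability.
Context {R : realType} {B : topConvType R}.
Implicit Types (L : lscfun R B) (nu : valuation R B).
Local Open Scope ereal_scope.

Let light (m : R) := (m < 1)%R.
Let rho (m : R) := (1 - m)%R.

Let rho_gt0 m : light m -> (0 < rho m)%R.
Proof. by rewrite subr_gt0. Qed.

Let rho_mono m m' : light m -> light m' -> (m <= m')%R ->
  (rho m <= rho m' + (m' - m))%R.
Proof. by move=> _ _ _; rewrite /rho addrA subrK. Qed.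

Let scaling (P : lscfun R B -> Prop) m : light m ->
  exists2 s : B -> B, continuous s & forall y L, P L -> L (s y) = (rho m + m)%:E * L y.
Proof.
move=> _; exists id; first by move=> x.
by move=> y L _; rewrite /rho subrK mul1e.
Qed.

Lemma barycenter_map_prob : convenient B -> compact [set: B] -> [set: B] !=set0 ->
  continuous_barycenter_map (@barycenter R B).
Proof.
move=> [tB sep lcc sobB] cB [b0 _].
apply: (@represents_map _ _ (@affine R B) rho light) => //.
- exact: affine0.
- exact: affine_add.
- exact: scaling.
- exact: initial_continuous.
move=> v; set nu := set_val v; have nu1 : nu opensT = 1 by exact: (set_valP v).
split; first by move=> xi; apply: mass_lt1; rewrite nu1.
move=> L aL Lfin e e0.
have [|x0 Lx0] := val_integral_lty_fin _ Lfin; first by rewrite nu1.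
have lE : L x0 = (fine (L x0))%:E by rewrite fineK // ge0_fin_numE ?lscfun_ge0.
have l0 : (0 <= fine (L x0))%R by rewrite fine_ge0 // lscfun_ge0.
have l1 : (0 < fine (L x0) + 1)%R by rewrite ltr_wpDl.
move: (fine (L x0)) lE l0 l1 => l lE l0 l1.
(* A defect of mass at most [e / (l + 1)], placed at a point of value [l]. *)
exists x0, (e / (l + 1))%R, 1%R; split; rewrite ?divr_gt0 //.
move=> m lm; rewrite nu1 minxx lee_fin lE -EFinM lee_fin => md.
rewrite -[leRHS](divfK (lt0r_neq0 l1)) ler_pM //; last by rewrite lerDl.
  by rewrite subr_ge0 ltW.
by rewrite /rho lerBlDl.
Qed.

Lemma barycenter_map_subprob (bot : B) : convenient B -> least bot ->
  continuous_barycenter_map (@pointed_barycenter R B bot).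
Proof.
move=> [tB sep lcc sobB] lb.
apply: (@represents_map _ _ (pointed_linear bot) rho light) => //.
- by move=> L [].
- by split; [exact: affine0|move=> a x; rewrite /= mule0].
- move=> L L' [aL bL] [aL' bL']; split; first exact: affine_add.
  by move=> a x /=; rewrite bL bL' ge0_muleDr ?lscfun_ge0.
- by move=> x y; exact: pointed_linear_separated.
- exact: scaling.
- exact: compact_least lb.
- exact: initial_continuous.
move=> v; set nu := set_val v; have nu1 : nu opensT <= 1 by exact: (set_valP v).
split; first by move=> xi; exact: mass_lt1.
move=> L [_ bL] _ e e0; exists bot, 1%R, 0%R; split => // m _ _.
by rewrite -(convmm (0%R : R)%:i01 bot) bL /= mul0e mule0 lee_fin ltW.
Qed.

End probability.

Section cone.
Context {R : realType} {C : topConeType R}.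
Implicit Types (L : lscfun R C) (nu : valuation R C).

Lemma cone_scaleE (a : {i01 R}) (x : C) :
  x <| a |> 0 = cone_scale (a%:num%:nng) x.
Proof. by rewrite cone_convE cone_scale0r addr0. Qed.

Lemma cone_linear_affine L : cone_linear L -> affine L.
Proof. by move=> [LD LZ] a x y; rewrite cone_convE LD !LZ. Qed.

(** Scalars above [1] are inverses of scalars below [1], and a sum is the midpoint
    of the doubled summands. *)
Lemma pointed_linear_cone L : pointed_linear (0 : C) L -> cone_linear L.
Proof.
move=> [aL bL].
have Lle1 (a : {nonneg R}) x : (a%:num <= 1) -> L (cone_scale a x) = (a%:num%:E * L x)%E.
  move=> a1; have a0 : 0 <= a%:num by []; pose p := Itv01 a0 a1.
  rewrite (_ : a = p%:num%:nng); last exact/val_inj.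
  by rewrite -cone_scaleE bL.
have LZ (a : {nonneg R}) x : L (cone_scale a x) = (a%:num%:E * L x)%E.
  have [a1|a1] := leP a%:num 1; first exact: Lle1.
  have a0 : (0 < a%:num) by exact: lt_trans a1.
  have b0 : 0 <= a%:num^-1 by rewrite invr_ge0.
  pose b : {nonneg R} := NngNum b0.
  have xE : x = cone_scale b (cone_scale a x).
    rewrite -cone_scaleA -[LHS]cone_scale1; congr cone_scale.
    by apply/val_inj; rewrite /= mulVf ?gt_eqF.
  have := Lle1 b (cone_scale a x).
  rewrite -xE /= invf_le1 // => ->; last exact: ltW.
  by rewrite muleA -EFinM divff ?gt_eqF // mul1e.
split=> // x y.
have h0 : 0 <= 2^-1 :> R by rewrite invr_ge0.
have h1 : 2^-1 <= 1 :> R by rewrite invf_le1 // ler1n.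
pose h : {i01 R} := Itv01 h0 h1; pose two : {nonneg R} := NngNum (ler0n R 2).
have half (b : {nonneg R}) (z : C) : b%:num = 2^-1 :> R ->
    cone_scale b (cone_scale two z) = z.
  move=> b2; rewrite -cone_scaleA -[RHS]cone_scale1; congr cone_scale.
  by apply/val_inj; rewrite /= b2 mulVf.
have -> : x + y = cone_scale two x <| h |> cone_scale two y.
  by rewrite cone_convE !half //=; lra.
rewrite aL !LZ !muleA -!EFinM /= mulVf // (_ : (1 - 2^-1) * 2 = 1 :> R).
  by rewrite !mul1e.
by lra.
Qed.

Lemma half_line_specialization (s t : half_line R) :
  (s : {nonneg R})%:num <= (t : {nonneg R})%:num -> specialization_le s t.
Proof.
move=> st U [D DI <-] [V DV Vs]; exists V => //.
have [I _ IV] := DI _ DV; rewrite -IV in Vs *.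
by move=> a aI /=; apply: lt_le_trans st; exact: Vs.
Qed.

(** [0 = 0 x <= 1 x = x], since [0 <= 1] in the Scott topology of the scalars and
    the action is continuous, hence monotone. *)
Lemma cone_least0 : least (0 : C).
Proof.
move=> x U oU; rewrite -(cone_scale0l x) -{2}[x]cone_scale1.
set z := (X in cone_scale X x); set o := (X in _ -> (U (cone_scale X x))) => Uz.
have [[A D] [/= Az Dx] AD] :=
  @cone_scale_continuous R C (z : half_line R, x) U (open_nbhs_nbhs (conj oU Uz)).
move: Az; rewrite nbhsE => -[A' [oA' A'z] A'A].
apply: (AD (o : half_line R, x)).
split; last exact: nbhs_singleton.
by apply: A'A; apply: half_line_specialization A'z.
Qed.

Lemma barycenter_map_cone : convenient C ->
  continuous_barycenter_map (@cone_barycenter R C).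
Proof.
move=> [tB sep lcc sobB].
apply: (@represents_map R C (@cone_linear R C) (fun=> 1) (fun m => 0 <= m)) => //.
- exact: cone_linear_affine.
- by split => [x y|a x] /=; rewrite ?adde0 ?mule0.
- move=> L L' [LD LZ] [L'D L'Z]; split => [x y|a x] /=.
    by rewrite LD L'D addeACA.
  by rewrite LZ L'Z ge0_muleDr ?lscfun_ge0.
- move=> x y /(pointed_linear_separated sep cone_least0)[L /pointed_linear_cone].
  by exists L.
- by move=> m m' _ _ mm'; rewrite lerDl subr_ge0.
- move=> m m0; have m1 : 0 <= 1 + m by rewrite addr_ge0.
  exists (cone_scale (NngNum m1)); last by move=> y L [_ ->].
  move=> x; have c : (NngNum m1 : half_line R, y) @[y --> x] --> (NngNum m1 : half_line R, x).
    by apply: (@cvg_pair _ _ _ (nbhs x) (nbhs (NngNum m1 : half_line R)) (nbhs x));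
      [exact: cvg_cst|exact: cvg_id].
  exact: (cvg_comp _ _ c (@cone_scale_continuous R C (NngNum m1 : half_line R, x))).
- exact: compact_least cone_least0.
- by move=> nu.
move=> nu; split; first by move=> xi _; exact: mass_ge0.
move=> L [_ LZ] _ e e0; exists 0, 1, 0; split => // m _ _.
by rewrite -(cone_scale0l 0) LZ mul0e mule0 lee_fin ltW.
Qed.

End cone.

Theorem theorem10p20 (R : realType) :
  (forall C : topConeType R, convenient C ->
     continuous_barycenter_map (@cone_barycenter R C)) /\
  (forall (B : topConvType R) (bot : B), convenient B -> least bot ->
     continuous_barycenter_map (@pointed_barycenter R B bot)) /\
  (forall B : topConvType R, convenient B ->
     compact [set: B] -> [set: B] !=set0 ->
     continuous_barycenter_map (@barycenter R B)).
Proof.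
split; first by move=> C; exact: barycenter_map_cone.
split; first by move=> B bot; exact: barycenter_map_subprob.
by move=> B; exact: barycenter_map_prob.
Qed.
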